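(* Let $G$ be a graph and let $n\geq 2$. Then the discrete fundamental group $A_1(G^{(n)})$ of the $n$th reduced power of $G$ is isomorphic to the first discrete singular cubical homology group $\mathcal{H}_1(G)$.
   Context: All graphs are connected, simple and locally finite. Write $u\simeq v$ if $u,v$ are adjacent or equal. A graph map $f:G\to H$ is a function on vertices with $u\simeq v\Rightarrow f(u)\simeq f(v)$. $\mathbb{Z}$ denotes the graph on the integers with $i\sim j$ iff $|i-j|=1$; $I_m$ is its induced subgraph on $\{0,\dots,m\}$. Reduced power: $G^{(n)}$ is the quotient of the Cartesian (box) product graph $G^n$ by the action of the symmetric group $\Sigma_n$ permuting coordinates. Equivalently its vertices are degree-$n$ monomials in the vertices of $G$ (multisets of $n$ tokens on vertices of $G$, overlaps allowed), and two monomials $\mathbf{x},\mathbf{y}$ are adjacent iff $\operatorname{lcm}(\mathbf{x},\mathbf{y})/\gcd(\mathbf{x},\mathbf{y})=uv$ for some adjacent vertices $u,v$ of $G$ (i.e. they differ by moving one token along one edge). Discrete fundamental group: fix $v_0\in G$. A graph map $f:\mathbb{Z}\to G$ is based if there is $r\geq 0$ with $f(i)=v_0$ for all $|i|\geq r$; let $r_f$ be the least such $r$. A based homotopy from $f$ to $g$ is a graph map $h:\mathbb{Z}\times I_m\to G$ (box product) such that $h(\cdot,0)=f$, $h(\cdot,m)=g$ and each $h(\cdot,j)$ is a based graph map. $A_1(G)=A_1(G,v_0)$ is the set of based homotopy classes, with product $[f][g]=[p]$ where $p(i)=f(i+r_f)$ for $i\le 0$ and $p(i)=g(i-r_g)$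 for $i\ge 0$; it is independent of $v_0$ up to isomorphism. Discrete singular cubical homology: $Q_0=I_0$ and $Q_n=I_1^n$ for $n\ge1$. $\mathcal{L}_n(G)$ is the free abelian group on graph maps $f:Q_n\to G$. For $1\le k\le n$, $D_k^{\pm}f:Q_{n-1}\to G$ are obtained by inserting $0$ (for $-$) or $1$ (for $+$) in the $k$th coordinate. $f$ is degenerate if $D_k^-f=D_k^+f$ for some $k$ (no map on $Q_0$ is degenerate). $\mathcal{C}_n(G)=\mathcal{L}_n(G)/\mathcal{D}_n(G)$ where $\mathcal{D}_n$ is spanned by degenerate maps, with boundary $\partial_n f=\sum_{k=1}^n(-1)^k(D_k^-f-D_k^+f)$. Then $\mathcal{H}_n(G)=\ker\partial_n/\operatorname{im}\partial_{n+1}$. *)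

(* Defs.v *)
From HB Require Import structures.
From mathcomp Require Import all_boot all_order all_algebra.
From mathcomp Require Import finmap multiset.
From Stdlib Require Import Relation_Operators.
Set Implicit Arguments. Unset Strict Implicit. Unset Printing Implicit Defensive.
Import Order.TTheory GRing.Theory Num.Theory.
Local Open Scope ring_scope.

Definition is_graph (V : eqType) (adj : V -> V -> Prop) : Prop :=
  [/\ (forall u v, adj u v -> adj v u),
      (forall u, ~ adj u u),
      (forall u v, clos_refl_trans V adj u v) &
      (forall u, exists s : seq V, forall w, adj u w -> w \in s)].

Definition weq (V : Type) (adj : V -> V -> Prop) (u v : V) : Prop :=
  u = v \/ adj u v.

(* vertices: degree-n monomials = multisets of size n on V *)
Definition monomial (V : choiceType) (n : nat) := {m : multiset V | size m == n}.

(* lcm(x,y)/gcd(x,y) = uv with u ~ v; lcm = msetU (pointwise max),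
   gcd = msetI (pointwise min), quotient = msetB, product = msetD *)
Definition red_adj (V : choiceType) (adj : V -> V -> Prop) (n : nat)
  (x y : monomial V n) : Prop :=
  exists u v, adj u v /\
    msetB (msetU (val x) (val y)) (msetI (val x) (val y))
    = msetD (msetn 1 u) (msetn 1 v).

Section A1.
Variables (W : Type) (adj : W -> W -> Prop) (w0 : W).

(* graph map Z -> H  (i ≃ j in Z iff |i - j| <= 1) *)
Definition Zmap (f : int -> W) : Prop :=
  forall i j : int, `|i - j| <= 1 -> weq adj (f i) (f j).

Definition based_at (f : int -> W) (r : nat) : Prop :=
  forall i : int, r%:Z <= `|i| -> f i = w0.

Definition based_loop (f : int -> W) : Prop :=
  Zmap f /\ exists r, based_at f r.

Definition least_radius (f : int -> W) (r : nat) : Prop :=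
  based_at f r /\ forall r', based_at f r' -> (r <= r')%N.

(* based homotopy h : Z x I_m -> H from f to g (box product) *)
Definition based_homotopic (f g : int -> W) : Prop :=
  exists (m : nat) (h : int -> nat -> W),
    [/\ (forall (i i' : int) (j j' : nat), (j <= m)%N -> (j' <= m)%N ->
           (i = i' /\ (j <= j'.+1)%N && (j' <= j.+1)%N) \/
           (`|i - i'| <= 1 /\ j = j') ->
           weq adj (h i j) (h i' j')),
        (forall i, h i 0%N = f i),
        (forall i, h i m = g i) &
        (forall j, (j <= m)%N -> exists r, based_at (fun i => h i j) r)].

Definition loop_product (f g p : int -> W) : Prop :=
  exists rf rg : nat, least_radius f rf /\ least_radius g rg /\
    forall i : int, (i <= 0 -> p i = f (i + rf%:Z)) /\
                    (0 <= i -> p i = g (i - rg%:Z)).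
End A1.

Definition Qv (n : nat) := {ffun 'I_n -> bool}.

Definition Qweq (n : nat) (x y : Qv n) : bool := (#|[set i | x i != y i]| <= 1)%N.

Section Cubical.
Variables (V : choiceType) (adj : V -> V -> Prop).

Definition cube_map (n : nat) (f : {ffun Qv n -> V}) : Prop :=
  forall x y : Qv n, Qweq x y -> weq adj (f x) (f y).

(* insert bit b in coordinate k (0-based; k = paper's index - 1) *)
Definition ins (n : nat) (k : 'I_n.+1) (b : bool) (t : Qv n) : Qv n.+1 :=
  [ffun i => if unlift k i is Some j then t j else b].

(* D_k^- (b = false) and D_k^+ (b = true) *)
Definition face (n : nat) (k : 'I_n.+1) (b : bool) (f : {ffun Qv n.+1 -> V})
  : {ffun Qv n -> V} := [ffun t => f (ins k b t)].

Definition degenerate (n : nat) : {ffun Qv n -> V} -> Prop :=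
  match n return {ffun Qv n -> V} -> Prop with
  | 0 => fun _ => False
  | m.+1 => fun f => exists k : 'I_m.+1, face k false f = face k true f
  end.

(* elements of L_n(G): formal integer combinations of maps Q_n -> G *)
Definition chain (n : nat) := seq (int * {ffun Qv n -> V}).

Definition is_chain (n : nat) (c : chain n) : Prop :=
  forall p, p \in c -> cube_map p.2.

Definition coef (n : nat) (c : chain n) (x : {ffun Qv n -> V}) : int :=
  \sum_(p <- c | p.2 == x) p.1.

Definition in_D (n : nat) (c : chain n) : Prop :=
  exists d : chain n, (forall p, p \in d -> cube_map p.2 /\ degenerate p.2) /\
    forall x, coef c x = coef d x.

Definition chain_opp (n : nat) (c : chain n) : chain n :=
  [seq (- p.1, p.2) | p <- c].
Definition chain_sub (n : nat) (c d : chain n) : chain n := c ++ chain_opp d.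

Definition boundary (n : nat) (c : chain n.+1) : chain n :=
  flatten [seq flatten [seq [:: ((-1) ^+ k.+1 * p.1, face k false p.2);
                                (- ((-1) ^+ k.+1 * p.1), face k true p.2)]
                           | k : 'I_n.+1 <- enum 'I_n.+1]
          | p : int * {ffun Qv n.+1 -> V} <- c].

(* z represents a class in ker ∂_1 ⊆ C_1(G) *)
Definition cycle1 (z : chain 1) : Prop := is_chain z /\ in_D (boundary z).

(* z - z' ∈ im ∂_2 in C_1(G) *)
Definition homologous1 (z z' : chain 1) : Prop :=
  exists w : chain 2, is_chain w /\ in_D (chain_sub (chain_sub z z') (boundary w)).
End Cubical.

(* Main.v *)
Require Import Defs.
From Stdlib Require Import Setoid Morphisms Relation_Operators.
From HB Require Import structures.
From mathcomp Require Import all_boot all_order all_algebra.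
From mathcomp Require Import finmap multiset.
From mathcomp Require Import boolp classical_sets zify ring.

(** A step of a loop in G^(n) moves one token along an edge (u,v) of G; [Phi]
    sends the loop to the sum of these edges.  Around a 4-cycle of G^(n) the
    four sources are a permutation of the four targets, so the four edges split
    into closed walks of length at most 4 in G, which are boundaries: hence
    [Phi] is invariant under homotopy.

    For the inverse, fix a vertex v0 and walks tau_v from v0 to v in G.  Moves of
    distinct tokens commute up to homotopy; therefore any loop in G^(n) is
    homotopic, up to conjugation by a fixed walk, to the product of the loops
    tau_u . (u,v) . tau_v^-1 performed by a single token while the n-1 others
    rest at v0.  As n >= 2, such loops commute with each other (let two different
    tokens perform them), so sending (u,v) to the loop above extends to chains,
    with values in an abelian group; squares of G go to null-homotopic loops.  On
    1-cycles the contributions of the walks tau_v cancel, so this map is inverse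
    to [Phi]. *)

Set Implicit Arguments. Unset Strict Implicit. Unset Printing Implicit Defensive.
Import Order.TTheory GRing.Theory Num.Theory.

(** * Walks up to homotopy *)

Section Walks.
Variables (T : eqType) (E : rel T).

(** Based homotopy in combinatorial form: waiting at a vertex, or replacing one side of a square by
    the other. For reflexive [E], degenerate squares also account for triangles and backtracking. *)
Inductive heq : seq T -> seq T -> Prop :=
| heq_refl s : heq s s
| heq_sym s t : heq s t -> heq t s
| heq_trans s t r : heq s t -> heq t r -> heq s r
| heq_stutter s1 x s2 : heq (s1 ++ x :: s2) (s1 ++ [:: x, x & s2])
| heq_square s1 a b c d s2 : E a b -> E b d -> E a c -> E c d ->
    heq (s1 ++ [:: a, b, d & s2]) (s1 ++ [:: a, c, d & s2]).

#[global] Instance heq_equivalence : Equivalence heq.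
Proof.
by split; [exact: heq_refl | exact: heq_sym | exact: heq_trans].
Qed.

Lemma heq_cat2l r s t : heq s t -> heq (r ++ s) (r ++ t).
Proof.
elim=> {s t} [s|s t _ IH|s t u _ IH1 _ IH2|s1 x s2|s1 a b c d s2 *].
- by reflexivity.
- by symmetry.
- by transitivity (r ++ t).
- by rewrite !catA; exact: heq_stutter.
- by rewrite !catA; apply: heq_square.
Qed.

Lemma heq_cat2r r s t : heq s t -> heq (s ++ r) (t ++ r).
Proof.
elim=> {s t} [s|s t _ IH|s t u _ IH1 _ IH2|s1 x s2|s1 a b c d s2 *].
- by reflexivity.
- by symmetry.
- by transitivity (t ++ r).
- by rewrite -!catA; exact: heq_stutter.
- by rewrite -!catA; apply: heq_square.
Qed.

#[global] Instance heq_cat : Proper (heq ==> heq ==> heq) cat.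
Proof.
move=> s s' ss' t t' tt'; transitivity (s' ++ t); first exact: heq_cat2r.
exact: heq_cat2l.
Qed.

#[global] Instance heq_cons x : Proper (heq ==> heq) (cons x).
Proof. by move=> s t; exact: (@heq_cat2l [:: x]). Qed.

(** Both endpoints are listed, so a product [s ++ t] of walks meeting at a vertex lists that vertex
    twice; the repetition is a stutter. *)
Definition walk (x y : T) (s : seq T) : bool :=
  if s is a :: t then [&& a == x, path E a t & last a t == y] else false.

Lemma walkP x y s :
  reflect (exists t, [/\ s = x :: t, path E x t & last x t = y]) (walk x y s).
Proof.
apply: (iffP idP) => [|[t [-> xt <-]]]; last by rewrite /= xt !eqxx.
by case: s => //= a t /and3P[/eqP-> xt /eqP <-]; exists t.
Qed.

Lemma walk_cons x x' y s : E x x' -> walk x' y s -> walk x y (x :: s).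
Proof. by move=> xx' /walkP[t [-> xt <-]] /=; rewrite xx' xt !eqxx. Qed.

Lemma walk1 x : walk x x [:: x]. Proof. by rewrite /= !eqxx. Qed.

Lemma walk_ind (P : T -> seq T -> Prop) y :
    P y [:: y] ->
    (forall x x' s, E x x' -> walk x' y s -> P x' s -> P x (x :: s)) ->
  forall x s, walk x y s -> P x s.
Proof.
move=> P1 PS x s; elim: s x => [|a s IHs] x //=.
case: s IHs => [_ /and3P[/eqP-> _ /eqP/= ->] //|b s IHs].
case/and3P=> /eqP-> /= /andP[ab bs] sy.
have ws : walk b y (b :: s) by rewrite /= bs sy eqxx.
by apply: PS ab (ws) _; exact: IHs.
Qed.

Lemma walk_cat x y y' z s t :
  walk x y s -> E y y' -> walk y' z t -> walk x z (s ++ t).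
Proof.
move=> xs yy' yt; elim/walk_ind: xs => [|{}x x' {}s xx' _]; first exact: walk_cons yt.
exact: walk_cons.
Qed.

Hypothesis Esym : symmetric E.

Lemma walk_rev x y s : walk x y s -> walk y x (rev s).
Proof.
elim/walk_ind => [|{}x x' {}s xx' _ IH]; first by rewrite /= !eqxx.
by rewrite rev_cons -cats1; apply: walk_cat IH _ (walk1 x); rewrite Esym.
Qed.

Lemma heq_absorbr x y s t : walk x y s -> heq (s ++ y :: t) (s ++ t).
Proof.
elim/walk_ind => [|{}x x' {}s _ _ IH]; last by rewrite /= IH; reflexivity.
by symmetry; exact: (heq_stutter [::]).
Qed.

Lemma heq_absorbl x y s : walk x y s -> heq (x :: s) s.
Proof. by case/walkP=> t [-> _ _]; symmetry; exact: (heq_stutter [::]). Qed.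

Hypothesis Erefl : reflexive E.

(** Contraction from the turning point outwards: the innermost [x, x', x] is the side of a
    degenerate square whose other side is [x, x, x]. *)
Lemma heq_backtrack x y s : walk x y s -> heq (s ++ rev s) [:: x].
Proof.
elim/walk_ind => [|{}x x' {}s xx' ws IH].
  by symmetry; exact: (heq_stutter [::]).
rewrite rev_cons -cats1 /= catA IH /=.
transitivity [:: x; x; x].
  by apply: (heq_square [::]); rewrite ?Erefl // Esym.
transitivity [:: x; x]; symmetry; exact: (heq_stutter [::]).
Qed.

Lemma heq_backtrackV x y s : walk x y s -> heq (rev s ++ s) [:: y].
Proof. by move/walk_rev/heq_backtrack; rewrite revK. Qed.

(** The crossing from [p] to [q] is pushed from the start to the end, one square at a time; [all2]
    supplies the rungs. *)
Lemma heq_ladder x y x' y' p q : walk x y p -> walk x' y' q -> all2 E p q ->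
  heq (x :: q) (p ++ [:: y']).
Proof.
move=> wp; elim/walk_ind: wp x' q => [|{}x z {}p xz wp IH] x' q.
  by case: q => [|b [|c q]] //=; rewrite ?andbF // => /andP[_ /eqP->] _; reflexivity.
case/walkP=> [[|b {}q] [-> qw qy]] /= /andP[xx' pq].
  by case/walkP: wp pq => t [->].
have wb : walk b y' (b :: q) by move: qw => /= /andP[_ ->]; rewrite -qy /= !eqxx.
rewrite -(IH b _ wb pq).
have zb : E z b by case/walkP: wp pq => t [-> _ _] /= /andP[].
by apply: (heq_square [::]) => //; case/andP: qw.
Qed.

End Walks.

Section MapWalks.
Variables (T U : eqType) (E : rel T) (F : rel U) (phi : T -> U).
Hypothesis phiE : {homo phi : x y / E x y >-> F x y}.

Lemma walk_map x y s : walk E x y s -> walk F (phi x) (phi y) (map phi s).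
Proof.
elim/walk_ind => [|{}x x' {}s xx' _ IH]; first by rewrite /= !eqxx.
by apply: walk_cons IH; exact: phiE.
Qed.

Lemma heq_map s t : heq E s t -> heq F (map phi s) (map phi t).
Proof.
elim=> {s t} [s|s t _ IH|s t u _ IH1 _ IH2|s1 x s2|s1 a b c d s2 *].
- by reflexivity.
- by symmetry.
- by transitivity (map phi t).
- by rewrite !map_cat; exact: heq_stutter.
- by rewrite !map_cat; apply: heq_square; exact: phiE.
Qed.
End MapWalks.

(** The two walks span a grid; each step of [p] sweeps one row of squares along [q] with
    [heq_ladder]. *)
Lemma heq_commute (T U : eqType) (E : rel T) (F : rel U) (phi : T -> T -> U) :
    (forall a b b', E b b' -> F (phi a b) (phi a b')) ->
    (forall a a' b, E a a' -> F (phi a b) (phi a' b)) ->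
  forall a b a' b' p q, walk E a b p -> walk E a' b' q ->
  heq F (map (phi^~ a') p ++ map (phi b) q) (map (phi a) q ++ map (phi^~ b') p).
Proof.
move=> phir phil a b a' b' p q wp wq.
have wqm c : walk F (phi c a') (phi c b') (map (phi c) q).
  by apply: walk_map wq => ? ?; exact: phir.
elim/walk_ind: wp => [|{}a c {}p ac wp IH] /=.
  rewrite (heq_absorbl (wqm b)) (heq_absorbr _ (wqm b)) cats0.
  by reflexivity.
rewrite IH -cat_cons (heq_ladder (wqm a) (wqm c)) //; last first.
  by elim: q {wq wqm IH} => //= d q ->; rewrite phil.
rewrite (heq_absorbr _ (wqm a)) -catA /=.
have wpm : walk F (phi c b') (phi b b') (map (phi^~ b') p).
  by apply: walk_map wp => ? ? ?; exact: phil.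
by rewrite (heq_absorbl wpm); reflexivity.
Qed.

(** * Based loops as walks *)

Definition weqb (T : Type) (adj : T -> T -> Prop) : rel T :=
  fun x y => `[< weq adj x y >].

Lemma weqbP (T : Type) (adj : T -> T -> Prop) x y :
  reflect (weq adj x y) (weqb adj x y).
Proof. exact: asboolP. Qed.

Section Loops.
Local Open Scope ring_scope.
Variables (W : eqType) (adj : W -> W -> Prop) (w0 : W).
Hypothesis adj_sym : forall u v, adj u v -> adj v u.

Lemma weqb_refl : reflexive (weqb adj).
Proof. by move=> x; apply/weqbP; left. Qed.

Lemma weqb_sym : symmetric (weqb adj).
Proof.
suff H x y : weqb adj x y -> weqb adj y x by move=> x y; apply/idP/idP; exact: H.
by move=> /weqbP[->|/adj_sym xy]; apply/weqbP; [left|right].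
Qed.

Lemma Zmap_succ (f : int -> W) :
  (forall i, weqb adj (f i) (f (i + 1))) -> Zmap adj f.
Proof.
move=> H i j ij.
have [->|[->|->]] : j = i \/ j = i + 1 \/ i = j + 1 by lia.
- by left.
- exact/weqbP.
- by apply/weqbP; rewrite weqb_sym.
Qed.

Lemma Zmap_weqb (f : int -> W) i : Zmap adj f -> weqb adj (f i) (f (i + 1)).
Proof. by move=> fZ; apply/weqbP; apply: fZ; lia. Qed.

Lemma based_at_leq (f : int -> W) r R :
  (r <= R)%N -> based_at w0 f r -> based_at w0 f R.
Proof. by move=> rR fr i iR; apply: fr; lia. Qed.

Lemma based_homotopic_step f g : based_loop adj w0 f -> based_loop adj w0 g ->
  (forall i, weqb adj (f i) (g i)) -> based_homotopic adj w0 f g.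
Proof.
move=> [fZ fb] [gZ gb] fg; exists 1%N, (fun i j => if j == 0%N then f i else g i).
split=> // [i i' j j' j1 j'1|[|j] _] //.
have [] : (j = 0 \/ j = 1)%N by lia.
  move=> ->; have [] : (j' = 0 \/ j' = 1)%N by lia.
    by move=> -> /= H; apply: fZ; lia.
  by move=> -> /= [[<- _]|[_]] //; exact/weqbP.
move=> ->; have [] : (j' = 0 \/ j' = 1)%N by lia.
  by move=> -> /= [[<- _]|[_]] //; apply/weqbP; rewrite weqb_sym.
by move=> -> /= H; apply: gZ; lia.
Qed.

Lemma based_homotopic_sym f g :
  based_homotopic adj w0 f g -> based_homotopic adj w0 g f.
Proof.
case=> m [h [hE h0 hm hb]]; exists m, (fun i j => h i (m - j)%N); split.
- by move=> i i' j j' jm j'm H; apply: hE; lia.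
- by move=> i; rewrite subn0.
- by move=> i; rewrite subnn.
- by move=> j jm; apply: hb; lia.
Qed.

Lemma based_homotopic_trans f g k : based_homotopic adj w0 f g ->
  based_homotopic adj w0 g k -> based_homotopic adj w0 f k.
Proof.
case=> m [h [hE h0 hm hb]] [m' [h' [hE' h0' hm' hb']]].
exists (m + m')%N, (fun i j => if (j <= m)%N then h i j else h' i (j - m)%N).
have hh' i : h' i 0%N = h i m by rewrite h0' hm.
split=> [i i' j j' jm j'm H|i|i|j jm] /=; first last.
- by case jmE: (j <= m)%N; [exact: hb | apply: hb'; lia].
- case: ifP => [mm|]; last by rewrite addKn hm'.
  have m'0 : m' = 0%N by lia.
  by rewrite m'0 addn0 hm -hm' m'0 h0'.
- exact: h0.
case: ifP => jle; case: ifP => j'le; try by [apply: hE; lia | apply: hE'; lia].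
- have -> : j = m by lia.
  by rewrite -hh'; apply: hE'; lia.
- have -> : j' = m by lia.
  by rewrite -hh'; apply: hE'; lia.
Qed.

Lemma shift_based_loop (f : int -> W) (k : nat) :
  based_loop adj w0 f -> based_loop adj w0 (fun i => f (i - k%:Z)).
Proof.
move=> [fZ [r fr]]; split=> [i j ij|]; first by apply: fZ; lia.
by exists (r + k)%N => i ir; apply: fr; lia.
Qed.

Lemma based_homotopic_refl f : based_loop adj w0 f -> based_homotopic adj w0 f f.
Proof. by move=> fb; apply: based_homotopic_step => // i; exact: weqb_refl. Qed.

(** Consecutive values of a graph map are adjacent or equal, so each shift by one is a single row of
    homotopy. *)
Lemma based_homotopic_shift (f : int -> W) (k : nat) :
  based_loop adj w0 f -> based_homotopic adj w0 f (fun i => f (i - k%:Z)).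
Proof.
move=> fb; elim: k => [|k IH].
  apply: based_homotopic_step => //; first exact: shift_based_loop.
  by move=> i; rewrite subr0 weqb_refl.
apply: based_homotopic_trans IH _.
apply: based_homotopic_step; [exact: shift_based_loop..|move=> i].
case: fb => fZ _; rewrite weqb_sym.
have -> : i - k%:Z = (i - k.+1%:Z) + 1 by lia.
exact: Zmap_weqb.
Qed.

(** The default [w0] of [nth] keeps the loop at rest once the list is exhausted. *)
Definition loop_of (s : seq W) (i : int) : W :=
  if i is Posz k then nth w0 s k else w0.

(** The base point is understood on both sides of the list, which itself need not begin or end
    there. *)
Definition closed_walk (s : seq W) : bool := path (weqb adj) w0 (rcons s w0).

Lemma nth_path_rcons a s k :
  path (weqb adj) a (rcons s w0) -> weqb adj (nth w0 (a :: s) k) (nth w0 s k).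
Proof.
elim: s a k => [|b s IH] a [|k] /=; rewrite ?nth_nil.
- by case/andP.
- by rewrite weqb_refl.
- by case/andP.
- by case/andP=> _ /(IH b k).
Qed.

Lemma loop_of_based s : closed_walk s -> based_loop adj w0 (loop_of s).
Proof.
move=> sw; split; last first.
  exists (size s) => -[k|k] //= ks; rewrite nth_default //; lia.
apply: Zmap_succ => -[k|[|k]].
- have -> : Posz k + 1 = Posz k.+1 by lia.
  exact: (nth_path_rcons k.+1 sw).
- exact: (nth_path_rcons 0 sw).
- have -> : Negz k.+1 + 1 = Negz k by lia.
  exact: weqb_refl.
Qed.

Lemma loop_of_step s t : closed_walk s -> closed_walk t ->
    (forall k, weqb adj (nth w0 s k) (nth w0 t k)) ->
  based_homotopic adj w0 (loop_of s) (loop_of t).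
Proof.
move=> sw tw st; apply: based_homotopic_step; [exact: loop_of_based..|].
by case=> // k; exact: weqb_refl.
Qed.

Lemma heq_closed_walk s t : heq (weqb adj) s t -> closed_walk s = closed_walk t.
Proof.
rewrite /closed_walk.
elim=> {s t} // [s t r _ -> _ -> //|s1 x s2|s1 a b c d s2 ab bd ac cd].
  by rewrite !rcons_cat !cat_path /= weqb_refl.
by rewrite !rcons_cat !cat_path /= ab bd ac cd.
Qed.

(** The repetition delays the tail by one step, so the two lists are adjacent entry by entry. *)
Lemma stutter_based_homotopic s1 x s2 : closed_walk (s1 ++ x :: s2) ->
  based_homotopic adj w0 (loop_of (s1 ++ x :: s2)) (loop_of (s1 ++ [:: x, x & s2])).
Proof.
move=> sw; apply: loop_of_step => [||k] //.
  by rewrite -(heq_closed_walk (heq_stutter _ s1 x s2)).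
move: sw; rewrite /closed_walk rcons_cat cat_path /= => /and3P[_ _].
elim: s1 k => [|e s1 IH] [|k] //=; rewrite ?weqb_refl // => xs; last exact: IH.
by rewrite weqb_sym; exact: nth_path_rcons.
Qed.

Lemma heq_based_homotopic s t : heq (weqb adj) s t -> closed_walk s ->
  based_homotopic adj w0 (loop_of s) (loop_of t).
Proof.
elim=> {s t} [s|s t st IH|s t r st IH1 tr IH2|s1 x s2|s1 a b c d s2 ab bd ac cd] sw.
- by apply: based_homotopic_refl; exact: loop_of_based.
- by apply/based_homotopic_sym/IH; rewrite (heq_closed_walk st).
- by apply: based_homotopic_trans (IH1 sw) (IH2 _); rewrite -(heq_closed_walk st).
- exact: stutter_based_homotopic.
(* Opposite corners of the square need not be adjacent: delay one walk at [d]
   and the other at [a], so that the rows [a b d d] and [a a c d] match. *)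
have abd : heq (weqb adj) (s1 ++ [:: a, b, d & s2]) (s1 ++ [:: a, b, d, d & s2]).
  by have := heq_stutter (weqb adj) (s1 ++ [:: a; b]) d s2; rewrite -!catA.
have sw' : closed_walk (s1 ++ [:: a, c, d & s2]).
  by rewrite -(heq_closed_walk (heq_square s1 s2 ab bd ac cd)).
have aacd := heq_stutter (weqb adj) s1 a [:: c, d & s2].
apply: (@based_homotopic_trans _ (loop_of (s1 ++ [:: a, b, d, d & s2]))).
  by have := @stutter_based_homotopic (s1 ++ [:: a; b]) d s2; rewrite -!catA; exact.
apply: (@based_homotopic_trans _ (loop_of (s1 ++ [:: a, a, c, d & s2]))); last first.
  by apply: based_homotopic_sym; exact: stutter_based_homotopic.
apply: loop_of_step => [||k]; rewrite -?(heq_closed_walk abd) -?(heq_closed_walk aacd) //.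
elim: s1 {sw sw' abd aacd} k => [|e s1 IH] k; last by case: k => [|k] /=; rewrite ?weqb_refl.
by case: k => [|[|[|k]]] /=; rewrite ?weqb_refl // weqb_sym.
Qed.

Definition segment (f : int -> W) (r : nat) : seq W :=
  mkseq (fun k => f (k%:Z - r%:Z)) (r + r).+1.

Lemma walk_mkseq (g : nat -> W) m : (forall k, weqb adj (g k) (g k.+1)) ->
  walk (weqb adj) (g 0%N) (g m) (mkseq g m.+1).
Proof.
move=> gE; elim: m => [|m IH]; first by rewrite /= !eqxx.
by rewrite mkseqS -cats1; apply: walk_cat IH (gE m) (walk1 _ _).
Qed.

Lemma segment_walk (f : int -> W) r : based_loop adj w0 f -> based_at w0 f r ->
  walk (weqb adj) w0 w0 (segment f r).
Proof.
move=> [fZ _] fr; rewrite /segment.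
set g := fun k : nat => f (k%:Z - r%:Z).
have -> : w0 = g 0%N by rewrite /g fr //; lia.
have {2}-> : g 0%N = g (r + r)%N by rewrite /g !fr //; lia.
apply: walk_mkseq => k; rewrite /g.
have -> : k.+1%:Z - r%:Z = k%:Z - r%:Z + 1 by lia.
exact: Zmap_weqb.
Qed.

Lemma walk_closed_walk s : walk (weqb adj) w0 w0 s -> closed_walk s.
Proof.
case/walkP=> t [-> wt tl]; rewrite /closed_walk /= weqb_refl rcons_path wt tl.
exact: weqb_refl.
Qed.

(** [loop_of] starts at time 0 but the window of [f] starts at [-r]; hence a preliminary shift by
    [r]. *)
Lemma based_homotopic_segment (f : int -> W) r :
    based_loop adj w0 f -> based_at w0 f r ->
  based_homotopic adj w0 f (loop_of (segment f r)).
Proof.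
move=> fb fr; apply: based_homotopic_trans (based_homotopic_shift r fb) _.
apply: based_homotopic_step; first exact: shift_based_loop.
  by apply: loop_of_based; apply: walk_closed_walk; exact: segment_walk.
move=> i; suff -> : loop_of (segment f r) i = f (i - r%:Z) by exact: weqb_refl.
case: i => [k|k] /=; last by rewrite fr //; lia.
have [kr|kr] := ltnP k (r + r).+1; first by rewrite nth_mkseq.
by rewrite nth_default ?size_mkseq // fr //; lia.
Qed.

Lemma heq_segment_homotopic (f g : int -> W) rf rg :
    based_loop adj w0 f -> based_loop adj w0 g ->
    based_at w0 f rf -> based_at w0 g rg ->
    heq (weqb adj) (segment f rf) (segment g rg) ->
  based_homotopic adj w0 f g.
Proof.
move=> fb gb fr gr fg.
apply: based_homotopic_trans (based_homotopic_segment fb fr) _.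
apply: based_homotopic_trans (based_homotopic_sym (based_homotopic_segment gb gr)).
by apply: heq_based_homotopic fg _; apply/walk_closed_walk/segment_walk.
Qed.
End Loops.

(** * Abelian groups as quotients by a congruence *)

Section QuotientGroup.
Local Open Scope ring_scope.
Local Open Scope quotient_scope.
Variables (T : choiceType) (R : T -> T -> Prop).
Variables (add : T -> T -> T) (opp : T -> T) (zero : T).
Hypotheses (Rxx : forall x, R x x) (Rsym : forall x y, R x y -> R y x)
  (Rtrans : forall x y z, R x y -> R y z -> R x z).
Hypothesis RD : forall x x' y y', R x x' -> R y y' -> R (add x y) (add x' y').
Hypotheses (addA : forall x y z, R (add x (add y z)) (add (add x y) z))
  (addC : forall x y, R (add x y) (add y x))
  (add0 : forall x, R (add zero x) x) (addN : forall x, R (add (opp x) x) zero).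

Let r : rel T := fun x y => `[< R x y >].
Let r_refl : reflexive r. Proof. by move=> x; exact/asboolP. Qed.
Let r_sym : symmetric r.
Proof. by move=> x y; apply/asboolP/asboolP; exact: Rsym. Qed.
Let r_trans : transitive r.
Proof. by move=> y x z /asboolP xy /asboolP yz; apply/asboolP; apply: Rtrans xy yz. Qed.
Let r_equiv := EquivRel r r_refl r_sym r_trans.
Local Notation Q := {eq_quot r_equiv}.

Let piP x y : (\pi_Q x = \pi_Q y) <-> R x y.
Proof.
by split=> [/eqmodP|xy]; [move/asboolP | apply/eqmodP/asboolP].
Qed.

Let reprP x : R (repr (\pi_Q x)) x.
Proof. by apply/piP; rewrite reprK. Qed.

Let qadd (a b : Q) : Q := \pi_Q (add (repr a) (repr b)).
Let qopp (a : Q) : Q := \pi_Q (opp (repr a)).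

Let qaddE x y : qadd (\pi_Q x) (\pi_Q y) = \pi_Q (add x y).
Proof. by apply/piP; apply: RD. Qed.

Let qaddA : associative qadd.
Proof.
move=> a b c; apply/piP; apply: Rtrans (RD (Rxx _) (reprP _)) _.
by apply: Rtrans (addA _ _ _) _; apply: RD (Rsym (reprP _)) (Rxx _).
Qed.
Let qaddC : commutative qadd.
Proof. by move=> a b; apply/piP; exact: addC. Qed.
Let qadd0 : left_id (\pi_Q zero) qadd.
Proof.
by move=> a; rewrite -[RHS]reprK; apply/piP; apply: Rtrans (RD (reprP _) (Rxx _)) _.
Qed.
Let qaddN : left_inverse (\pi_Q zero) qopp qadd.
Proof.
by move=> a; apply/piP; apply: Rtrans (RD (reprP _) (Rxx _)) (addN _).
Qed.

HB.instance Definition _ := GRing.isZmodule.Build Q qaddA qaddC qadd0 qaddN.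

(** Turns homotopy classes into a [zmodType], in which integer chains can be evaluated. *)
Lemma quotient_zmodType : exists (A : zmodType) (pi : T -> A),
  [/\ forall x y, pi x = pi y <-> R x y,
      forall x y, pi (add x y) = pi x + pi y & pi zero = 0].
Proof.
by exists Q, (\pi_Q); split.
Qed.
End QuotientGroup.

(** * Chains and edges *)

Section ChainSums.
Local Open Scope ring_scope.
Variables (V : choiceType) (n : nat).
Implicit Types (c d : chain V n) (x : {ffun Qv n -> V}).

Lemma coef_cons p c x : coef (p :: c) x = p.1 *+ (p.2 == x) + coef c x.
Proof. by rewrite /coef big_cons; case: eqP => _; rewrite ?mulr1n // mulr0n add0r. Qed.

Lemma coef_cat c d x : coef (c ++ d) x = coef c x + coef d x.
Proof. exact: big_cat. Qed.

Lemma coef_opp c x : coef (chain_opp c) x = - coef c x.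
Proof. by rewrite /coef /chain_opp big_map /= -sumrN. Qed.

Lemma coef_sub c d x : coef (chain_sub c d) x = coef c x - coef d x.
Proof. by rewrite coef_cat coef_opp. Qed.

Variables (A : zmodType) (F : {ffun Qv n -> V} -> A).
(** The linear extension of [F] to formal combinations. *)
Definition chain_eval c : A := \sum_(p <- c) F p.2 *~ p.1.

Lemma chain_eval_coef c (K : seq {ffun Qv n -> V}) :
    uniq K -> {subset [seq p.2 | p <- c] <= K} ->
  chain_eval c = \sum_(x <- K) F x *~ coef c x.
Proof.
move=> Ku; rewrite /chain_eval; elim: c => [|p c IH] cK.
  by rewrite big_nil big1 // => x _; rewrite /coef big_nil mulr0z.
rewrite big_cons IH; last by move=> x xc; apply: cK; rewrite inE xc orbT.
have pK : p.2 \in K by apply: cK; rewrite inE eqxx.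
under [in RHS]eq_bigr => x _ do rewrite coef_cons mulrzDr.
rewrite big_split /=; congr (_ + _).
rewrite (bigD1_seq p.2) //= eqxx mulr1n big1 ?addr0 // => x xp.
by rewrite eq_sym (negPf xp) mulr0n mulr0z.
Qed.

(** Lists with equal coefficients represent the same element of the free group: both sums are
    regrouped over a common duplicate-free list of maps. *)
Lemma eq_chain_eval c d : coef c =1 coef d -> chain_eval c = chain_eval d.
Proof.
move=> cd; pose K := undup ([seq p.2 | p <- c] ++ [seq p.2 | p <- d]).
rewrite !(@chain_eval_coef _ K) ?undup_uniq //.
- by apply: eq_bigr => x _; rewrite cd.
- by move=> x xd; rewrite mem_undup mem_cat xd orbT.
- by move=> x xd; rewrite mem_undup mem_cat xd.
Qed.

Lemma chain_eval_cat c d : chain_eval (c ++ d) = chain_eval c + chain_eval d.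
Proof. exact: big_cat. Qed.

Lemma chain_eval_sub c d : chain_eval (chain_sub c d) = chain_eval c - chain_eval d.
Proof.
rewrite chain_eval_cat; congr (_ + _).
rewrite /chain_eval big_map -sumrN; apply: eq_bigr => p _ /=.
by rewrite mulrNz.
Qed.

Lemma chain_eval_boundary (c : chain V n.+1) :
  chain_eval (boundary c) = \sum_(p <- c) \sum_(k < n.+1)
    (F (face k false p.2) - F (face k true p.2)) *~ ((-1) ^+ k.+1 * p.1).
Proof.
rewrite /chain_eval /boundary big_flatten /= big_map; apply: eq_bigr => p _.
rewrite big_flatten /= big_map big_enum; apply: eq_bigr => k _.
by rewrite !big_cons big_nil /= addr0 mulrNz mulrzBl.
Qed.
End ChainSums.

(** Coefficients are linear functionals, so the results on [chain_eval] apply to them. *)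
Lemma coef_chain_eval (V : choiceType) n (c : chain V n) x :
  coef c x = chain_eval (fun y => (y == x)%:R%R : int) c.
Proof.
rewrite /chain_eval /coef big_mkcond; apply: eq_bigr => p _.
by case: eqP => _; rewrite ?mul0rz // mulrzz mul1r.
Qed.

Section Edges.
Local Open Scope ring_scope.
Variables (V : choiceType) (adj : V -> V -> Prop).
Hypothesis adj_sym : forall u v, adj u v -> adj v u.
Notation E := (weqb adj).
Notation X0 := {ffun Qv 0 -> V}.
Notation X1 := {ffun Qv 1 -> V}.
Notation X2 := {ffun Qv 2 -> V}.

Definition pt0 (v : V) : X0 := [ffun=> v].
Definition edge (u v : V) : X1 := [ffun t : Qv 1 => if t ord0 then v else u].
Definition src (x : X1) : V := x [ffun=> false].
Definition tgt (x : X1) : V := x [ffun=> true].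

Lemma Qv1E (t : Qv 1) : t = [ffun=> t ord0].
Proof. by apply/ffunP=> i; rewrite ffunE ord1. Qed.

Lemma Qv0E (t t' : Qv 0) : t = t'.
Proof. by apply/ffunP; case. Qed.

Lemma src_edge u v : src (edge u v) = u. Proof. by rewrite /src !ffunE. Qed.
Lemma tgt_edge u v : tgt (edge u v) = v. Proof. by rewrite /tgt !ffunE. Qed.

Lemma edgeE x : x = edge (src x) (tgt x).
Proof. by apply/ffunP=> t; rewrite ffunE [t]Qv1E ffunE; case: (t ord0). Qed.

Lemma pt0_inj : injective pt0.
Proof. by move=> u v /ffunP/(_ [ffun=> false]); rewrite !ffunE. Qed.

Lemma face_edge (k : 'I_1) b x : face k b x = pt0 (if b then tgt x else src x).
Proof.
apply/ffunP=> t; rewrite !ffunE.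
have -> : ins k b t = [ffun=> b].
  apply/ffunP=> i; rewrite !ffunE [i]ord1 [k]ord1.
  by case: unliftP => // j; case: (ord0 : 'I_0) j => ? [].
by case: b.
Qed.

Lemma cube_map_edge x : cube_map adj x <-> E (src x) (tgt x).
Proof.
split=> [H|/weqbP H].
  by apply/weqbP/H; rewrite /Qweq (leq_trans (max_card _)) ?card_ord.
move=> s t _; rewrite (Qv1E s) (Qv1E t).
case: (s ord0) (t ord0) => -[]; [by left | | exact: H | by left].
by apply/weqbP; rewrite weqb_sym //; apply/weqbP.
Qed.

Lemma degenerate_edge x : degenerate x <-> src x = tgt x.
Proof.
split=> [[k]|H]; first by rewrite !face_edge => /pt0_inj.
by exists ord0; rewrite !face_edge H.
Qed.

Definition q2 (a b : bool) : Qv 2 := [ffun i => if i == ord0 then a else b].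

Lemma Qv2E (t : Qv 2) : t = q2 (t ord0) (t ord_max).
Proof.
apply/ffunP=> i; rewrite ffunE; case: ifP => [/eqP-> //|i0]; congr (t _).
by apply: val_inj; case: i i0 => -[|[|]].
Qed.

Lemma ins0E b t : ins (ord0 : 'I_2) b t = q2 b (t ord0).
Proof.
apply/ffunP=> i; rewrite !ffunE; case: unliftP => [j ->|->]; last by [].
by rewrite (ord1 j).
Qed.

Lemma ins1E b t : ins (ord_max : 'I_2) b t = q2 (t ord0) b.
Proof.
apply/ffunP=> i; rewrite !ffunE; case: unliftP => [j ->|-> //].
by rewrite (ord1 j).
Qed.

(** Corners are ordered so that [a, b, d] and [a, c, d] are the two sides, as in [heq_square]. *)
Definition square (a b c d : V) : X2 :=
  [ffun t : Qv 2 => if t ord0 then (if t ord_max then d else c)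
                    else (if t ord_max then b else a)].

Lemma cube_map_square a b c d : E a b -> E b d -> E a c -> E c d ->
  cube_map adj (square a b c d).
Proof.
move=> ab bd ac cd s t; rewrite /Qweq => st.
have {st} : (s ord0 == t ord0) || (s ord_max == t ord_max).
  apply: contraLR st; rewrite negb_or -ltnNge => /andP[s0 s1].
  apply: (@leq_trans #|[set (ord0 : 'I_2); ord_max]|); first by rewrite cards2.
  by apply/subset_leq_card/fintype.subsetP => i; rewrite !inE => /orP[]/eqP->.
have S := weqb_sym adj_sym.
rewrite !ffunE; case: (s ord0) (t ord0) (s ord_max) (t ord_max) => -[] [] [] //= _;
 by [left | apply/weqbP => // | apply/weqbP; rewrite S].
Qed.

Lemma face_square a b c d :
  [/\ face ord0 false (square a b c d) = edge a b,
      face ord0 true (square a b c d) = edge c d,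
      face ord_max false (square a b c d) = edge a c &
      face ord_max true (square a b c d) = edge b d].
Proof. by split; apply/ffunP=> t; rewrite ffunE ?ins0E ?ins1E !ffunE. Qed.

Lemma Qweq_q2l a b b' : Qweq (q2 a b) (q2 a b').
Proof.
apply: (@leq_trans #|[set (ord_max : 'I_2)]|); last by rewrite cards1.
apply/subset_leq_card/fintype.subsetP => i.
by rewrite !inE !ffunE; case: i => -[|[|]] //=; rewrite eqxx.
Qed.

Lemma Qweq_q2r a a' b : Qweq (q2 a b) (q2 a' b).
Proof.
apply: (@leq_trans #|[set (ord0 : 'I_2)]|); last by rewrite cards1.
apply/subset_leq_card/fintype.subsetP => i.
by rewrite !inE !ffunE; case: ifP; rewrite // eqxx.
Qed.

Lemma squareE (f : X2) : cube_map adj f -> exists a b c d,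
  [/\ f = square a b c d, E a b, E b d, E a c & E c d].
Proof.
move=> fE; exists (f (q2 false false)), (f (q2 false true)), (f (q2 true false)), (f (q2 true true)).
split.
- by apply/ffunP=> t; rewrite ffunE {1}[t]Qv2E; do 2!case: (t _).
all: by apply/weqbP/fE; rewrite ?Qweq_q2l ?Qweq_q2r.
Qed.
End Edges.

(** * Null 1-chains *)

Section NullChains.
Local Open Scope ring_scope.
Variables (V : choiceType) (adj : V -> V -> Prop).
Hypothesis adj_sym : forall u v, adj u v -> adj v u.
Notation E := (weqb adj).
Notation X1 := {ffun Qv 1 -> V}.

(** Boundaries modulo degenerate chains, expressed on coefficient functions so that linear
    combinations can be compared pointwise by [ring]. *)
Definition null (F : X1 -> int) : Prop :=
  exists (w : chain V 2) (d : chain V 1),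
    [/\ is_chain adj w,
        forall p, p \in d -> cube_map adj p.2 /\ degenerate p.2 &
        forall x, F x = coef (boundary w) x + coef d x].

Lemma homologous1P z z' :
  homologous1 adj z z' <-> null (fun x => coef z x - coef z' x).
Proof.
split=> [[w [wc [d [dd H]]]]|[w [d [wc dd H]]]].
  by exists w, d; split=> // x; have := H x; rewrite !coef_sub; lia.
exists w; split=> //; exists d; split=> // x.
by rewrite !coef_sub H; lia.
Qed.

Lemma null_ext F G : null F -> F =1 G -> null G.
Proof. by move=> [w [d [wc dd H]]] FG; exists w, d; split=> // x; rewrite -FG. Qed.

Lemma null0 : null (fun=> 0).
Proof. by exists [::], [::]; split=> // x; rewrite /coef !big_nil. Qed.

Lemma boundary_cat n (c d : chain V n.+1) : boundary (c ++ d) = boundary c ++ boundary d.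
Proof. by rewrite /boundary map_cat flatten_cat. Qed.

Lemma coef_boundary_opp n (c : chain V n.+1) x :
  coef (boundary (chain_opp c)) x = - coef (boundary c) x.
Proof.
rewrite !coef_chain_eval !chain_eval_boundary big_map -sumrN; apply: eq_bigr => p _.
by rewrite -sumrN; apply: eq_bigr => k _ /=; rewrite mulrN mulrNz.
Qed.

Lemma null_add F G : null F -> null G -> null (fun x => F x + G x).
Proof.
move=> [w [d [wc dd H]]] [w' [d' [wc' dd' H']]]; exists (w ++ w'), (d ++ d'); split.
- by move=> p; rewrite mem_cat => /orP[/wc|/wc'].
- by move=> p; rewrite mem_cat => /orP[/dd|/dd'].
- by move=> x; rewrite boundary_cat !coef_cat H H' addrACA.
Qed.

Lemma null_opp F : null F -> null (fun x => - F x).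
Proof.
move=> [w [d [wc dd H]]]; exists (chain_opp w), (chain_opp d); split.
- by move=> p /mapP[q /wc qc ->].
- by move=> p /mapP[q /dd qc ->].
- by move=> x; rewrite coef_boundary_opp coef_opp H opprD.
Qed.

Lemma null_sub F G : null F -> null G -> null (fun x => F x - G x).
Proof. by move=> nF nG; apply: null_add nF (null_opp nG). Qed.

Lemma null_mulz F (m : int) : null F -> null (fun x => F x * m).
Proof.
have nat_case k : null F -> null (fun x => F x * k%:Z).
  move=> nF; elim: k => [|k IH]; first by apply: null_ext null0 _ => x; rewrite mulr0.
  by apply: null_ext (null_add IH nF) _ => x; rewrite intS; ring.
case: m => k nF; first exact: nat_case.
by apply: null_ext (null_opp (nat_case k.+1 nF)) _ => x; rewrite NegzE; ring.
Qed.

Definition e1 (u v : V) (x : X1) : int := (edge u v == x)%:R.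

Lemma null_e1xx u : null (e1 u u).
Proof.
exists [::], [:: (1, edge u u)]; split=> //.
  move=> p; rewrite inE => /eqP-> /=; split.
    by apply/cube_map_edge => //; rewrite src_edge tgt_edge weqb_refl.
  by apply/degenerate_edge; rewrite src_edge tgt_edge.
by move=> x; rewrite coef_cons /coef !big_nil addr0 add0r.
Qed.

Lemma null_e1_square a b c d : E a b -> E b d -> E a c -> E c d ->
  null (fun x => e1 a b x + e1 b d x - e1 a c x - e1 c d x).
Proof.
(* With the signs of [boundary], the square has boundary [ac + cd - ab - bd]; hence the coefficient
   -1. *)
move=> ab bd ac cd; exists [:: (-1, square a b c d)], [::]; split=> //.
  by move=> p; rewrite inE => /eqP->; exact: cube_map_square.
move=> x; rewrite coef_chain_eval chain_eval_boundary big_seq1 /coef big_nil addr0.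
have [/= f1 f2 f3 f4] := face_square a b c d.
rewrite big_ord_recl big_ord1 -(_ : ord_max = lift ord0 ord0 :> 'I_2); last exact: val_inj.
by rewrite f1 f2 f3 f4 /= /e1 !mulrzz /bump /=; ring.
Qed.

(** One square replaces [ab + bc] by [ad + dc]; two folded squares, with a constant second side,
    cancel these edges against their reverses. *)
Lemma null_cycle4 a b c d : E a b -> E b c -> E c d -> E d a ->
  null (fun x => e1 a b x + e1 b c x + e1 c d x + e1 d a x).
Proof.
move=> ab bc cd da; have Es := weqb_sym adj_sym; have Er := weqb_refl adj.
have ad : E a d by rewrite Es.
have dc : E d c by rewrite Es.
have H1 := null_e1_square ab bc ad dc.
have H2 := null_e1_square ad da (Er a) (Er a).
have H3 := null_e1_square dc cd (Er d) (Er d).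
have n1 := null_e1xx a; have n2 := null_e1xx d.
apply: null_ext (null_add (null_add (null_add (null_add H1 H2) H3) (null_add n1 n1)) (null_add n2 n2)) _ => x.
by ring.
Qed.

Lemma null_cycle3 a b c : E a b -> E b c -> E c a ->
  null (fun x => e1 a b x + e1 b c x + e1 c a x).
Proof.
move=> ab bc ca; apply: null_ext (null_sub (null_cycle4 (weqb_refl adj a) ab bc ca) (null_e1xx a)) _.
by move=> x; ring.
Qed.

Lemma null_cycle2 a b : E a b -> null (fun x => e1 a b x + e1 b a x).
Proof.
move=> ab; have ba : E b a by rewrite weqb_sym.
apply: null_ext (null_sub (null_cycle3 (weqb_refl adj a) ab ba) (null_e1xx a)) _.
by move=> x; ring.
Qed.

Lemma perm_consP (T : eqType) (v : T) vs us : perm_eq (v :: vs) us ->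
  exists s1 s2, us = s1 ++ v :: s2 /\ perm_eq vs (s1 ++ s2).
Proof.
move=> p; have vus : v \in us by rewrite -(perm_mem p) mem_head.
exists (take (index v us) us), (drop (index v us).+1 us).
have usE : us = take (index v us) us ++ v :: drop (index v us).+1 us.
  have <- : drop (index v us) us = v :: drop (index v us).+1 us.
    by rewrite (drop_nth v) ?index_mem // nth_index.
  by rewrite cat_take_drop.
split=> //; rewrite -(perm_cons v) (perm_trans p) // [X in perm_eq X]usE.
by rewrite -cat1s perm_catCA.
Qed.

(** Shorter cycles are extracted first and their edges consumed; the goal is then the sum of the
    null chains collected. *)
Ltac null_cycles :=
  repeat match goal with
  | H : is_true (weqb _ ?a ?a) |- _ => move: (null_e1xx a) => ?; clear H
  | H1 : is_true (weqb _ ?a ?b), H2 : is_true (weqb _ ?b ?a) |- _ =>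
      move: (null_cycle2 H1) => ?; clear H1 H2
  | H1 : is_true (weqb _ ?a ?b), H2 : is_true (weqb _ ?b ?c),
    H3 : is_true (weqb _ ?c ?a) |- _ =>
      move: (null_cycle3 H1 H2 H3) => ?; clear H1 H2 H3
  | H1 : is_true (weqb _ ?a ?b), H2 : is_true (weqb _ ?b ?c),
    H3 : is_true (weqb _ ?c ?d), H4 : is_true (weqb _ ?d ?a) |- _ =>
      move: (null_cycle4 H1 H2 H3 H4) => ?; clear H1 H2 H3 H4
  end;
  repeat match goal with
  | N1 : null _, N2 : null _ |- _ => move: (null_add N1 N2) => ?; clear N1 N2
  end;
  match goal with N : null _ |- _ => apply: null_ext N _ => x /=; ring end.

(* A permutation of four vertices splits into directed cycles of length at
   most four, each of which bounds. *)
Lemma null_perm4 u0 v0 u1 v1 u2 v2 u3 v3 :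
    E u0 v0 -> E u1 v1 -> E u2 v2 -> E u3 v3 ->
    perm_eq [:: v0; v1; v2; v3] [:: u0; u1; u2; u3] ->
  null (fun x => e1 u0 v0 x + e1 u1 v1 x + e1 u2 v2 x + e1 u3 v3 x).
Proof.
move=> E0 E1 E2 E3.
(* Locating each target in turn among the remaining sources leaves one goal per permutation. *)
case/perm_consP=> -[|? [|? [|? [|? ?]]]] [s2 [] /= H].
all: try by exfalso; move/(congr1 size): H; rewrite /= ?size_cat /=; lia.
all: case: H => *; subst.
all: match goal with P : is_true (perm_eq _ _) |- _ => move: P end.
all: case/perm_consP=> -[|? [|? [|? ?]]] [s2' [] /= H].
all: try by exfalso; move/(congr1 size): H; rewrite /= ?size_cat /=; lia.
all: case: H => *; subst.
all: match goal with P : is_true (perm_eq _ _) |- _ => move: P end.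
all: case/perm_consP=> -[|? [|? ?]] [s2'' [] /= H].
all: try by exfalso; move/(congr1 size): H; rewrite /= ?size_cat /=; lia.
all: case: H => *; subst.
all: match goal with P : is_true (perm_eq _ _) |- _ => move: P end.
all: case/perm_consP=> -[|? ?] [s2''' [] /= H].
all: try by exfalso; move/(congr1 size): H; rewrite /= ?size_cat /=; lia.
all: case: H => *; subst.
all: null_cycles.
Qed.
End NullChains.

(** * Monomials and moves *)

Section Monomials.
Variables (V : choiceType) (adj : V -> V -> Prop) (n : nat) (w0 : monomial V n)
  (v0 : V).
Hypothesis adj_sym : forall u v, adj u v -> adj v u.
Hypothesis adj_irr : forall u, ~ adj u u.
Notation E := (weqb adj).
Notation W := (monomial V n).
Notation EW := (weqb (@red_adj V adj n)).

(* [mon s] is the junk value [w0] unless [size s = n]. *)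
Definition mon (s : seq V) : W := insubd w0 (seq_mset s).

Lemma size_seq_mset (s : seq V) : size (seq_mset s) = size s.
Proof. exact: perm_size (perm_eq_seq_mset s). Qed.

Lemma val_mon s : size s = n -> val (mon s) = seq_mset s.
Proof. by move=> sn; rewrite val_insubd size_seq_mset sn eqxx. Qed.

Lemma mon_junk s : size s <> n -> mon s = w0.
Proof.
move=> sn; rewrite /mon /insubd insubN //; apply/eqP => sE; apply: sn.
by rewrite -sE size_seq_mset.
Qed.

Lemma mon_perm s t : perm_eq s t -> mon s = mon t.
Proof. by rewrite /mon => /eq_seq_msetP ->. Qed.

Lemma mon_enum (x : W) : mon (val x) = x.
Proof. by rewrite /mon seq_mset_id valKd. Qed.

Lemma size_monomial (x : W) : size (val x) = n.
Proof. exact/eqP/(valP x). Qed.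

Lemma red_adj_sym (x y : W) : red_adj adj x y -> red_adj adj y x.
Proof.
by move=> [u [v [uv H]]]; exists u, v; split=> //; rewrite msetUC (msetIC (val y)).
Qed.

Lemma weqb_mon u v c : E u v -> EW (mon (u :: c)) (mon (v :: c)).
Proof.
have [sc|sc] := eqVneq (size c).+1 n; last first.
  by move=> _; rewrite !mon_junk ?weqb_refl //; apply/eqP.
move/weqbP => [->|uv]; first exact: weqb_refl.
have uNv : u != v by apply/eqP => vE; apply: (@adj_irr u); rewrite {2}vE.
apply/weqbP; right; exists u, v; split=> //.
apply/msetP => w; rewrite !msetE2 !val_mon // !mset_seqE !msetnE /=.
rewrite (eq_sym u) (eq_sym v).
case: (eqVneq w u) => [->|_]; case: (eqVneq _ v) => [wv|_] //=; try lia.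
by rewrite wv eqxx in uNv.
Qed.

(** The equation at [u] forces a token of [x] there; removing it leaves the common part [c]. *)
Lemma move_split (x y : W) u v : u != v ->
    (forall w, val x w + (w == v) = val y w + (w == u))%N ->
  exists c, [/\ (size c).+1 = n, x = mon (u :: c) & y = mon (v :: c)].
Proof.
move=> uNv H.
have ux : u \in enum_mset (val x).
  have := H u; rewrite eqxx (negPf uNv) => Hu.
  by rewrite -has_pred1 has_count count_mem_mset; lia.
have px := perm_to_rem ux; exists (rem u (val x)); split.
- by move/perm_size: px; rewrite size_monomial.
- by rewrite -[LHS]mon_enum; exact: mon_perm.
rewrite -[LHS]mon_enum; apply/mon_perm/allP => w _ /=; apply/eqP.
move/permP: px => /(_ (pred1 w)) /=; rewrite !count_mem_mset.
have := H w; rewrite /= (eq_sym u) (eq_sym v); lia.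
Qed.

(** The quotient of lcm by gcd records the absolute difference of multiplicities, which is 1 at [u]
    and [v] and 0 elsewhere. Equal degrees force opposite signs at [u] and [v], so one token moves,
    in one direction or the other. *)
Lemma red_adj_split (x y : W) : red_adj adj x y -> exists u v c,
  [/\ adj u v, (size c).+1 = n, x = mon (u :: c) & y = mon (v :: c)].
Proof.
move=> [u [v [uv H]]].
have uNv : u != v by apply/eqP => vE; apply: (@adj_irr u); rewrite {2}vE.
have Hw w : (maxn (val x w) (val y w) - minn (val x w) (val y w) = (w == u) + (w == v))%N.
  by move/msetP/(_ w): H; rewrite !msetE2 !msetnE => ->; do 2!case: eqP.
have Hu := Hw u; have Hv := Hw v; rewrite eqxx (negPf uNv) in Hu.
rewrite eqxx eq_sym (negPf uNv) in Hv.
have not_perm (a b : W) : ~ perm_eq (val a) [:: u, v & val b].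
  by move/perm_size; rewrite /= !size_monomial; lia.
have cases w : w = u \/ w = v \/ (w == u = false /\ w == v = false).
  by do 2!case: eqP; auto.
have vNu : v == u = false by rewrite eq_sym (negPf uNv).
have [xu|xu] := ltnP (val y u) (val x u); have [xv|xv] := ltnP (val y v) (val x v).
- exfalso; apply: (@not_perm x y); apply/allP => w _ /=.
  rewrite !count_mem_mset (eq_sym u) (eq_sym v).
  move: (Hw w) Hu Hv xu xv; rewrite /=; have [->|[->|[-> ->]]] := cases w; rewrite ?eqxx ?vNu ?(negPf uNv); lia.
- have [|c [sc xE yE]] := @move_split x y u v uNv; last by exists u, v, c.
  move=> w; have := Hw w; have [->|[->|[-> ->]]] := cases w; rewrite ?eqxx ?vNu ?(negPf uNv); lia.
- have [||c [sc xE yE]] := @move_split x y v u; first by rewrite vNu.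
    move=> w; have := Hw w; have [->|[->|[-> ->]]] := cases w; rewrite ?eqxx ?vNu ?(negPf uNv); lia.
  by exists v, u, c; split=> //; exact: adj_sym.
- exfalso; apply: (@not_perm y x); apply/allP => w _ /=.
  rewrite !count_mem_mset (eq_sym u) (eq_sym v).
  move: (Hw w) Hu Hv xu xv; rewrite /=; have [->|[->|[-> ->]]] := cases w; rewrite ?eqxx ?vNu ?(negPf uNv); lia.
Qed.

(** The case [p.1 = p.2] is allowed, so that a stationary step also carries a label. *)
Definition is_move (x y : W) (p : V * V) : Prop :=
  E p.1 p.2 /\ exists c, [/\ (size c).+1 = n, x = mon (p.1 :: c) & y = mon (p.2 :: c)].

Lemma is_move_count (x y : W) p : is_move x y p ->
  forall w, (val x w + (p.2 == w) = val y w + (p.1 == w))%N.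
Proof.
by move=> [_ [c [sc -> ->]]] w; rewrite !val_mon // !mset_seqE /=; lia.
Qed.

Lemma is_move_sym (x y : W) p : is_move x y p -> is_move y x (p.2, p.1).
Proof. by move=> [pE [c [sc xE yE]]]; split; [rewrite weqb_sym | exists c]. Qed.

Lemma is_move_mon u v c : (size c).+1 = n -> E u v ->
  is_move (mon (u :: c)) (mon (v :: c)) (u, v).
Proof. by move=> sc uv; split=> //; exists c. Qed.

(** Adding the four balances of [is_move_count] around the cycle equates the multisets of sources
    and targets, as [null_perm4] requires. *)
Lemma null_moves4 (x0 x1 x2 x3 : W) p0 p1 p2 p3 :
    is_move x0 x1 p0 -> is_move x1 x2 p1 -> is_move x2 x3 p2 -> is_move x3 x0 p3 ->
  null adj (fun x => e1 p0.1 p0.2 x + e1 p1.1 p1.2 x + e1 p2.1 p2.2 x + e1 p3.1 p3.2 x)%R.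
Proof.
move=> m0 m1 m2 m3; apply: null_perm4; [exact: adj_sym|exact: m0.1|exact: m1.1|exact: m2.1|exact: m3.1|].
apply/allP => w _ /=; apply/eqP.
have := is_move_count m0 w; have := is_move_count m1 w.
have := is_move_count m2 w; have := is_move_count m3 w; lia.
Qed.

Hypothesis n_gt0 : (0 < n)%N.

Lemma weqb_move (x y : W) : EW x y -> exists p, is_move x y p.
Proof.
move/weqbP=> [<-|/red_adj_split[u [v [c [uv sc xE yE]]]]]; last first.
  by exists (u, v); split; [apply/weqbP; right | exists c].
(* A stationary step is labelled by [(u, u)] for a token [u] of [x], which exists as [n > 0]. *)
case xE : (enum_mset (val x)) (mon_enum x) (size_monomial x) => [|u c] mx sx.
  by move: n_gt0; rewrite -sx.
by exists (u, u); split; [exact: weqb_refl | exists c].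
Qed.

Definition lab (x y : W) : V * V := xget (v0, v0) [set p | is_move x y p]%classic.

Lemma labP (x y : W) : EW x y -> is_move x y (lab x y).
Proof. by move/weqb_move/(xgetPex (v0, v0)). Qed.
End Monomials.

(** * Words in the edges of G *)

Lemma walk_catr (T : eqType) (E : rel T) x y z s t :
  walk E x y s -> walk E y z (y :: t) -> walk E x z (s ++ t).
Proof.
move=> /walkP[s' [-> ps <-]] /= /and3P[_ pt lt].
by rewrite eqxx cat_path last_cat ps pt lt.
Qed.

Lemma walk_rcons (T : eqType) (E : rel T) x y s :
  walk E x y s -> exists s', s = rcons s' y.
Proof.
by case/walkP=> t [-> _ <-]; exists (belast x t); rewrite lastI.
Qed.

Section Words.
Variables (V : choiceType) (adj : V -> V -> Prop) (v0 : V) (n : nat).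
Hypothesis adj_sym : forall u v, adj u v -> adj v u.
Hypothesis adj_conn : forall u v, clos_refl_trans V adj u v.
Hypothesis n_gt1 : (1 < n)%N.
Notation E := (weqb adj).
Let Erefl := weqb_refl adj.
Let Esym := weqb_sym adj_sym.

(** An abstract model of the reduced power: configurations named by lists of tokens up to order,
    with single-token moves. *)
Variables (U : eqType) (EU : rel U) (mon : seq V -> U).
Hypothesis EUrefl : reflexive EU.
Hypothesis EUsym : symmetric EU.
Hypothesis mon_perm : forall s t, perm_eq s t -> mon s = mon t.
Hypothesis mon_homo : forall u v c, E u v -> EU (mon (u :: c)) (mon (v :: c)).

Lemma walk_exists v : exists s, walk E v0 v s.
Proof.
elim: (adj_conn v0 v) => [x y xy|x|x y z _ [s ws] _ [t wt]].
- by exists [:: x; y]; apply: walk_cons (walk1 _ _); apply/weqbP; right.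
- by exists [:: x]; exact: walk1.
- by exists (s ++ t); exact: walk_cat ws (Erefl y) wt.
Qed.

Definition tau (v : V) : seq V := xget [::] [set s | walk E v0 v s]%classic.

Lemma tauP v : walk E v0 v (tau v).
Proof. exact: (xgetPex [::] (walk_exists v)). Qed.

(** A pair that is not an edge gives the empty list, so every word spells a closed walk at [v0] and
    words form a group without side conditions. *)
Definition ell (p : V * V) : seq V :=
  if E p.1 p.2 then tau p.1 ++ rev (tau p.2) else [::].

Definition wordwalk (ws : seq (V * V)) : seq V := flatten [seq ell p | p <- ws].

Lemma wordwalk_cat ws ws' : wordwalk (ws ++ ws') = wordwalk ws ++ wordwalk ws'.
Proof. by rewrite /wordwalk map_cat flatten_cat. Qed.

Lemma ell_walk p : walk E v0 v0 (v0 :: ell p).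
Proof.
rewrite /ell; case: ifP => [pE|_]; last exact: walk1.
by apply: walk_cons (Erefl v0) _; apply: walk_cat (tauP _) pE (walk_rev Esym (tauP _)).
Qed.

Lemma wordwalkP ws : walk E v0 v0 (v0 :: wordwalk ws).
Proof.
elim: ws => [|p ws IH]; first exact: walk1.
by rewrite -cat_cons; apply: walk_catr (ell_walk p) IH.
Qed.

Definition swap_word (ws : seq (V * V)) := rev [seq (p.2, p.1) | p <- ws].

Lemma wordwalk_swap ws : wordwalk (swap_word ws) = rev (wordwalk ws).
Proof.
elim: ws => //= p ws IH; rewrite /swap_word /= rev_cons -cats1 wordwalk_cat IH.
rewrite /wordwalk /= cats0 rev_cat; congr (_ ++ _).
by rewrite /ell /= Esym; case: ifP => //; rewrite rev_cat revK.
Qed.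

Definition inc (w : V) : U := mon (w :: nseq n.-1 v0).

Lemma inc_homo : {homo inc : u v / E u v >-> EU u v}.
Proof. by move=> u v; exact: mon_homo. Qed.

Definition incwalk (ws : seq (V * V)) : seq U := inc v0 :: map inc (wordwalk ws).

Lemma incwalkP ws : walk EU (inc v0) (inc v0) (incwalk ws).
Proof. exact: (walk_map inc_homo (wordwalkP ws)). Qed.

Lemma incwalk_cat ws ws' : heq EU (incwalk (ws ++ ws')) (incwalk ws ++ incwalk ws').
Proof.
rewrite {1}/incwalk wordwalk_cat map_cat -cat_cons.
by symmetry; exact: heq_absorbr (incwalkP ws).
Qed.

(** As [n >= 2], a second token can perform [ws']: [inc a] is both [phi a v0] and [phi v0 a], and
    [heq_commute] applies to [phi]. *)
Lemma incwalkC ws ws' : heq EU (incwalk (ws ++ ws')) (incwalk (ws' ++ ws)).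
Proof.
rewrite !incwalk_cat; pose phi a b := mon [:: a, b & nseq n.-2 v0].
have n2E : n.-1 = n.-2.+1 by lia.
have incl a : inc a = phi a v0 by rewrite /inc n2E.
have incr a : inc a = phi v0 a.
  by rewrite incl; apply: mon_perm; rewrite (perm_catCA [:: a] [:: v0]).
have -> : incwalk ws = map (phi^~ v0) (v0 :: wordwalk ws) by rewrite -(eq_map incl).
have -> : incwalk ws' = map (phi v0) (v0 :: wordwalk ws') by rewrite -(eq_map incr).
apply: heq_commute (wordwalkP ws) (wordwalkP ws') => [a b b' bb'|a a' b aa'].
  rewrite /phi (@mon_perm [:: a, b & _] [:: b, a & nseq n.-2 v0]).
    rewrite (@mon_perm [:: a, b' & _] [:: b', a & nseq n.-2 v0]) ?mon_homo //.
    by rewrite (perm_catCA [:: a] [:: b']).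
  by rewrite (perm_catCA [:: a] [:: b]).
exact: mon_homo.
Qed.

Lemma incwalkN ws : heq EU (incwalk (swap_word ws ++ ws)) (incwalk [::]).
Proof.
rewrite incwalk_cat {1}/incwalk wordwalk_swap.
have wi := incwalkP ws; have := heq_backtrackV EUsym EUrefl wi.
rewrite {1}/incwalk rev_cons -map_rev -cats1 -catA /= (heq_absorbl wi) => H.
by rewrite H; symmetry; exact: (heq_stutter _ [::]).
Qed.

Lemma word_group : exists (A : zmodType) (pi : seq (V * V) -> A),
  [/\ forall ws ws', pi ws = pi ws' <-> heq EU (incwalk ws) (incwalk ws'),
      forall ws ws', pi (ws ++ ws') = (pi ws + pi ws')%R & pi [::] = 0%R].
Proof.
apply: (@quotient_zmodType _ _ _ swap_word).
- by move=> x; reflexivity.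
- by move=> x y; symmetry.
- by move=> x y z xy yz; transitivity (incwalk y).
- by move=> x x' y y' xx' yy'; rewrite !incwalk_cat xx' yy'; reflexivity.
- by move=> x y z; rewrite catA; reflexivity.
- exact: incwalkC.
- by move=> x; reflexivity.
- exact: incwalkN.
Qed.

Lemma incwalk_refl u : heq EU (incwalk [:: (u, u)]) (incwalk [::]).
Proof.
apply: (heq_map inc_homo (s := v0 :: _) (t := [:: v0])).
rewrite /wordwalk /= cats0 /ell /= Erefl (heq_backtrack Esym Erefl (tauP u)).
by symmetry; exact: (heq_stutter _ [::]).
Qed.

(** The return from [b] to [v0] cancels against the next departure to [b]. *)
Lemma wordwalk2 a b d : E a b -> E b d ->
  heq E (wordwalk [:: (a, b); (b, d)]) (tau a ++ b :: rev (tau d)).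
Proof.
move=> ab bd; rewrite /wordwalk /= cats0 /ell /= ab bd -catA (catA (rev _)).
by rewrite (heq_backtrackV Esym Erefl (tauP b)); reflexivity.
Qed.

Lemma incwalk_square a b c d : E a b -> E b d -> E a c -> E c d ->
  heq EU (incwalk [:: (a, b); (b, d)]) (incwalk [:: (a, c); (c, d)]).
Proof.
move=> ab bd ac cd; apply: (heq_map inc_homo (s := v0 :: _) (t := v0 :: _)).
rewrite !wordwalk2 //; apply: heq_cons.
have [s ->] := walk_rcons (tauP a); have [t ->] := walk_rcons (tauP d).
by rewrite rev_rcons !cat_rcons; exact: heq_square.
Qed.

Definition word_chain (ws : seq (V * V)) : chain V 1 :=
  [seq (1%R, edge p.1 p.2) | p <- ws].

(** The linear extension of [psi] kills degenerate edges and boundaries of squares, hence descends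
    to homology, and it sends the chain of a word to the class of its loop. *)
Lemma homologous_word_chain ws ws' :
    homologous1 adj (word_chain ws) (word_chain ws') ->
  heq EU (incwalk ws) (incwalk ws').
Proof.
have [A [pi [piP piD pi0]]] := word_group.
pose psi (x : {ffun Qv 1 -> V}) := pi [:: (src x, tgt x)].
have psi_word us : chain_eval psi (word_chain us) = pi us.
  elim: us => [|p us IH]; first by rewrite /chain_eval big_nil pi0.
  rewrite -cat1s piD -IH /chain_eval /= big_cons /= mulr1z /psi src_edge tgt_edge.
  by case: p.
have pi_refl u : pi [:: (u, u)] = 0%R by rewrite -pi0; apply/piP; exact: incwalk_refl.
move=> [w [wc [d [dd /(eq_chain_eval psi)]]]].
rewrite !chain_eval_sub !psi_word.
have -> : chain_eval psi d = 0%R.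
  rewrite /chain_eval big_seq big1 // => p /dd[_ /degenerate_edge pE].
  by rewrite /psi pE pi_refl mul0rz.
have -> : chain_eval psi (boundary w) = 0%R.
  rewrite chain_eval_boundary big_seq big1 // => p /wc.
  move=> /squareE [a [b [c [e [-> ab be ac ce]]]]].
  have [/= f1 f2 f3 f4] := face_square a b c e.
  rewrite big_ord_recl big_ord1 -(_ : ord_max = lift ord0 ord0 :> 'I_2); last exact: val_inj.
  rewrite f1 f2 f3 f4 /psi !src_edge !tgt_edge.
  have H : (pi [:: (a, b)] + pi [:: (b, e)] = pi [:: (a, c)] + pi [:: (c, e)])%R.
    by rewrite -!piD; apply/piP; exact: incwalk_square.
  have -> : (pi [:: (a, c)] - pi [:: (b, e)] = pi [:: (a, b)] - pi [:: (c, e)])%R.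
    by apply/eqP; rewrite subr_eq addrAC eq_sym subr_eq H.
  by rewrite /= expr1 expr2 mulN1r mulrNN !mul1r mulrNz addNr.
by move=> /eqP; rewrite subr0 subr_eq0 => /eqP /piP.
Qed.

(** The tokens of [c] travel one by one from [v0] to their places, those of [d] being already in
    position. *)
Fixpoint spread (d c : seq V) : seq U :=
  if c is u :: c' then
    [seq mon (w :: d ++ nseq (size c') v0) | w <- tau u] ++ spread (u :: d) c'
  else [:: mon d].

Lemma mon_mid w d t : mon (d ++ w :: t) = mon (w :: d ++ t).
Proof. by apply: mon_perm; rewrite -(perm_catCA [:: w] d). Qed.

Lemma spread_walk d c :
  walk EU (mon (d ++ nseq (size c) v0)) (mon (d ++ c)) (spread d c).
Proof.
elim: c d => [|u c IH] d /=; first by rewrite cats0 !eqxx.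
rewrite !mon_mid; apply: walk_cat (EUrefl _) (IH (u :: d)).
by apply: walk_map (tauP u) => a b; exact: mon_homo.
Qed.

Lemma spread_permd d d' c : perm_eq d d' -> spread d c = spread d' c.
Proof.
elim: c d d' => [|u c IH] d d' dd' /=; first by rewrite (mon_perm dd').
congr (_ ++ _); last by apply: IH; rewrite perm_cons.
by apply: eq_map => w; apply: mon_perm; rewrite perm_cons perm_cat2r.
Qed.

Lemma mon_swap a b c : mon [:: a, b & c] = mon [:: b, a & c].
Proof. by apply: mon_perm; rewrite (perm_catCA [:: a] [:: b]). Qed.

Lemma mon_homo2 a b b' c : E b b' -> EU (mon [:: a, b & c]) (mon [:: a, b' & c]).
Proof. by rewrite !(mon_swap a); exact: mon_homo. Qed.

(** The trips of two successive tokens commute by [heq_commute]; the later trips depend on the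
    placed tokens only up to order. *)
Lemma spread_swap d u v c : heq EU (spread d [:: u, v & c]) (spread d [:: v, u & c]).
Proof.
pose phi a b := mon [:: a, b & d ++ nseq (size c) v0].
have phil w : mon (w :: d ++ v0 :: nseq (size c) v0) = phi w v0.
  by apply: mon_perm; rewrite perm_cons -(perm_catCA [:: v0] d).
have phir w : mon (w :: d ++ v0 :: nseq (size c) v0) = phi v0 w.
  by rewrite phil /phi mon_swap.
rewrite /= (@spread_permd [:: v, u & d] [:: u, v & d]); last first.
  by rewrite (perm_catCA [:: v] [:: u]).
rewrite (eq_map phil) (eq_map phir) !catA; apply: heq_cat; last by reflexivity.
rewrite (eq_map (fun w => mon_swap w u _ : _ = phi u w)).
by apply: heq_commute (tauP u) (tauP v) => *; [exact: mon_homo2 | exact: mon_homo].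
Qed.

Lemma spread_front d s1 u s2 : heq EU (spread d (s1 ++ u :: s2)) (spread d (u :: s1 ++ s2)).
Proof.
elim: s1 d => [|x s1 IH] d; first by reflexivity.
rewrite -spread_swap [X in heq _ X]/= IH /= !size_cat /= addnS.
by reflexivity.
Qed.

(** Needed because a monomial determines its list of tokens only up to order. *)
Lemma spread_perm d c c' : perm_eq c c' -> heq EU (spread d c) (spread d c').
Proof.
elim: c d c' => [|u c IH] d c' p.
  by have /perm_nilP -> : perm_eq c' [::]; [rewrite perm_sym | reflexivity].
have [s1 [s2 [-> p']]] := perm_consP p; rewrite spread_front /=.
by rewrite (perm_size p') (IH _ _ p'); reflexivity.
Qed.

Lemma spread_ladder d d' c : (forall t, EU (mon (d ++ t)) (mon (d' ++ t))) ->
  all2 EU (spread d c) (spread d' c).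
Proof.
elim: c d d' => [|u c IH] d d' dd' /=.
  by have := dd' [::]; rewrite !cats0 => ->.
have dd'1 w t : EU (mon (w :: d ++ t)) (mon (w :: d' ++ t)).
  by rewrite -!mon_mid.
elim: (tau u) => [|w s IHs] /=; last by rewrite dd'1.
by apply: IH => t; exact: dd'1.
Qed.

(* The move of one token from [u] to [v] slides along the walks of the other
   tokens, so its contribution does not depend on [c]. *)
Lemma spread_move u v c : E u v -> (size c).+1 = n ->
  heq EU (spread [::] (u :: c) ++ [:: mon (v :: c)])
         (map inc (ell (u, v)) ++ spread [::] (v :: c)).
Proof.
move=> uv sc; have cE : size c = n.-1 by rewrite -sc.
rewrite /= cE -/inc -catA.
have wu := spread_walk [:: u] c; have wv := spread_walk [:: v] c.
have wi a := walk_map inc_homo (tauP a).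
rewrite -(heq_ladder wu wv); last by apply: spread_ladder => t; exact: mon_homo.
rewrite /= cE in wv *; rewrite (heq_absorbr _ (wi u)).
rewrite /ell /= uv map_cat map_rev -catA (catA (rev _)).
rewrite (heq_backtrackV EUsym EUrefl (wi v)) /= (heq_absorbl wv).
by reflexivity.
Qed.

(** * Loops of configurations as conjugates of words *)

Variables (enc : U -> seq V) (lab : U -> U -> V * V).
Hypothesis enc_mon : forall c, size c = n -> perm_eq (enc (mon c)) c.
Hypothesis mon_enc : forall x, mon (enc x) = x.
Hypothesis size_enc : forall x, size (enc x) = n.
Hypothesis labP : forall x y, EU x y -> E (lab x y).1 (lab x y).2 /\
  exists c, [/\ (size c).+1 = n, x = mon ((lab x y).1 :: c) & y = mon ((lab x y).2 :: c)].

Definition gamma (x : U) : seq U := spread [::] (enc x).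

Lemma gamma_walk x : walk EU (inc v0) x (gamma x).
Proof.
have := spread_walk [::] (enc x); rewrite /= mon_enc size_enc.
by rewrite /inc -[n in nseq n](prednK (ltnW n_gt1)).
Qed.

Lemma gamma_step x y : EU x y ->
  heq EU (gamma x ++ [:: y]) (map inc (ell (lab x y)) ++ gamma y).
Proof.
move=> /labP; case: (lab x y) => u v /= [uv [c [sc xE yE]]].
have pu : perm_eq (enc x) (u :: c) by rewrite xE enc_mon.
have pv : perm_eq (enc y) (v :: c) by rewrite yE enc_mon.
by rewrite /gamma (spread_perm _ pu) (spread_perm _ pv) yE; exact: spread_move.
Qed.

(** Iterating [gamma_step], the reference walk [gamma] advances along the path and leaves behind the
    word of its labels. *)
Lemma gamma_path x s : path EU x s ->
  heq EU (gamma x ++ s)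
    (map inc (wordwalk (pairmap lab x s)) ++ gamma (last x s)).
Proof.
elim: s x => [|y s IH] x /=; first by rewrite cats0; reflexivity.
case/andP=> xy ys; rewrite -cat1s catA (gamma_step xy) -catA (IH _ ys).
by rewrite /wordwalk /= map_cat -catA; reflexivity.
Qed.

Lemma gamma_loop x s : path EU x s -> last x s = x ->
  heq EU (x :: s) (rev (gamma x) ++ incwalk (pairmap lab x s) ++ gamma x).
Proof.
move=> xs sx; have wg := gamma_walk x.
transitivity ((rev (gamma x) ++ gamma x) ++ s).
  by rewrite (heq_backtrackV EUsym EUrefl wg); reflexivity.
rewrite -catA (gamma_path xs) sx /incwalk cat_cons.
by rewrite (heq_absorbr _ (walk_rev EUsym wg)); reflexivity.
Qed.

Lemma homologous_loops x s t :
    path EU x s -> last x s = x -> path EU x t -> last x t = x ->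
    homologous1 adj (word_chain (pairmap lab x s)) (word_chain (pairmap lab x t)) ->
  heq EU (x :: s) (x :: t).
Proof.
move=> xs sx xt tx st; rewrite (gamma_loop xs sx) (gamma_loop xt tx).
by rewrite (homologous_word_chain st); reflexivity.
Qed.

End Words.

(** * Chains along walks *)

Section WalkSums.
Local Open Scope ring_scope.
Variables (V : choiceType) (adj : V -> V -> Prop).
(** [D] gives the chain of one step; it is later [e1] on G and [step_chain] on the reduced power. *)
Variables (T : eqType) (E : rel T) (D : T -> T -> {ffun Qv 1 -> V} -> int).
Notation null := (null adj).
Hypothesis D_refl : forall x, null (D x x).
Hypothesis D_sym : forall x y, E x y -> null (fun z => D x y z + D y x z).

Fixpoint wsum (s : seq T) (z : {ffun Qv 1 -> V}) : int :=
  if s is x :: t then (if t is y :: _ then D x y z else 0) + wsum t z else 0.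

Lemma wsum_cons x x' y s z : walk E x' y s -> wsum (x :: s) z = D x x' z + wsum s z.
Proof. by case/walkP=> t [->]. Qed.

Lemma wsum_cat x y y' u s t z : walk E x y s -> walk E y' u t ->
  wsum (s ++ t) z = wsum s z + D y y' z + wsum t z.
Proof.
move=> ws wt; elim/walk_ind: ws => [|{}x x' {}s xx' ws IH].
  by rewrite (wsum_cons _ _ wt) /=; ring.
rewrite cat_cons (wsum_cons _ _ ws).
case/walkP: ws IH => r [-> _ _] IH.
by rewrite /= in IH *; rewrite IH; ring.
Qed.

Lemma wsum_catr x y u s t z : walk E x y s -> walk E y u (y :: t) ->
  wsum (s ++ t) z = wsum s z + wsum (y :: t) z.
Proof.
move=> ws; elim/walk_ind: ws => [|{}x x' {}s xx' ws IH] wt.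
  by rewrite /=; ring.
rewrite cat_cons (wsum_cons _ _ ws).
case/walkP: ws (IH wt) => r [-> _ _] H.
by rewrite /= in H *; rewrite H; ring.
Qed.

Hypothesis Esym : symmetric E.

Lemma wsum_rev x y s : walk E x y s -> null (fun z => wsum (rev s) z + wsum s z).
Proof.
elim/walk_ind => [|{}x x' {}s xx' ws IH].
  by apply: null_ext (null0 adj) _ => z.
apply: null_ext (null_add (D_sym xx') IH) _ => z.
rewrite rev_cons -cats1 (wsum_cat _ (walk_rev Esym ws) (walk1 E x)) (wsum_cons _ _ ws) /=.
by ring.
Qed.

Definition zsum (f : int -> T) (a : int) (m : nat) (z : {ffun Qv 1 -> V}) : int :=
  \sum_(0 <= k < m) D (f (a + k%:Z)) (f (a + k%:Z + 1)) z.

Lemma zsum_add f a m m' z : zsum f a (m + m') z = zsum f a m z + zsum f (a + m%:Z) m' z.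
Proof.
rewrite /zsum (big_cat_nat (n := m)) ?leq_addr //=; congr (_ + _).
rewrite -{1}[m]add0n big_addn addKn; apply: eq_bigr => k _.
by have -> : a + (k + m)%N%:Z = a + m%:Z + k%:Z by lia.
Qed.

Lemma zsumS f a m z :
  zsum f a m.+1 z = zsum f a m z + D (f (a + m%:Z)) (f (a + m%:Z + 1)) z.
Proof. by rewrite /zsum big_nat_recr. Qed.

Lemma zsum_mkseq f a m z : zsum f a m z = wsum (mkseq (fun k => f (a + k%:Z)) m.+1) z.
Proof.
elim: m a => [|m IH] a; first by rewrite /zsum big_nil /= !addr0.
have -> : mkseq (fun k => f (a + k%:Z)) m.+2 = f a :: mkseq (fun k => f (a + 1 + k%:Z)) m.+1.
  apply: (@eq_from_nth _ (f a)) => [|i]; rewrite size_mkseq.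
    by rewrite /= size_map size_iota.
  move=> im; rewrite nth_mkseq //; case: i im => [|i] im; first by rewrite addr0.
  transitivity (nth (f a) (mkseq (fun k => f (a + 1 + k%:Z)) m.+1) i) => //.
  by rewrite nth_mkseq //; congr f; lia.
by rewrite -add1n zsum_add IH {1}/zsum big_nat1 /= !addr0.
Qed.

Lemma zsum_const (w0 : T) f a m : (forall i, a <= i <= a + m%:Z -> f i = w0) ->
  null (zsum f a m).
Proof.
elim: m => [|m IH] H; first by apply: null_ext (null0 adj) _ => z; rewrite /zsum big_nil.
apply: null_ext (null_add (IH _) (D_refl w0)) _; first by move=> i ia; apply: H; lia.
by move=> z; rewrite zsumS !H //; lia.
Qed.

Lemma zsum_window (w0 : T) f a m a' m' : a <= a' -> a' + m'%:Z <= a + m%:Z ->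
    (forall i, a <= i <= a' -> f i = w0) ->
    (forall i, a' + m'%:Z <= i <= a + m%:Z -> f i = w0) ->
  null (fun z => zsum f a m z - zsum f a' m' z).
Proof.
(* [m1] and [m2] are the lengths of the stretches at rest before and after the inner window. *)
move=> aa' mm' f1 f2; pose m1 := absz (a' - a)%R.
pose m2 := absz (a + m%:Z - a' - m'%:Z)%R.
have a'E : a' = a + m1%:Z by rewrite /m1; lia.
have mE : m = (m1 + (m' + m2))%N by rewrite /m1 /m2; lia.
have n1 : null (zsum f a m1) by apply: zsum_const => i; rewrite -a'E; exact: f1.
have n2 : null (zsum f (a' + m'%:Z) m2).
  by apply: zsum_const => i ii; apply: f2; move: ii; rewrite /m2; lia.
apply: null_ext (null_add n1 n2) _ => z.
by rewrite mE !zsum_add -a'E; ring.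
Qed.

Lemma zsum_based (w0 : T) f r a m : based_at w0 f r -> a <= - r%:Z -> r%:Z <= a + m%:Z ->
  null (fun z => zsum f a m z - zsum f (- r%:Z) (r + r) z).
Proof.
by move=> fr ar rm; apply: (@zsum_window w0) => [||i ii|i ii]; try apply: fr; lia.
Qed.

Hypothesis D_square : forall x y z t, E x y -> E y z -> E z t -> E t x ->
  null (fun c => D x y c + D y z c + D z t c + D t x c).

(** Each column of the ladder is a square; the inner rungs telescope and only the two end rungs
    survive. *)
Lemma zsum_ladder f g a m :
    (forall i, E (f i) (f (i + 1))) -> (forall i, E (g i) (g (i + 1))) ->
    (forall i, E (f i) (g i)) ->
  null (fun z => zsum f a m z + D (f (a + m%:Z)) (g (a + m%:Z)) z
                 - D (f a) (g a) z - zsum g a m z).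
Proof.
move=> fE gE fg; elim: m => [|m IH].
  apply: null_ext (null0 adj) _ => z; rewrite /zsum !big_nil !addr0; ring.
set i := a + m%:Z in IH.
have H1 := D_square (fE i) (fg (i + 1)) (_ : E (g (i + 1)) (g i)) (_ : E (g i) (f i)).
have {}H1 := H1 (etrans (Esym _ _) (gE i)) (etrans (Esym _ _) (fg i)).
have H2 := D_sym (fg i); have H3 := D_sym (gE i).
apply: null_ext (null_add IH (null_sub H1 (null_add H2 H3))) _ => z.
rewrite !zsumS -/i (_ : a + m.+1%:Z = i + 1); last by rewrite /i; lia.
by ring.
Qed.
End WalkSums.

(** * The isomorphism *)

Section ReducedPower.
Local Open Scope ring_scope.
Variables (V : choiceType) (adj : V -> V -> Prop) (n : nat) (w0 : monomial V n)
  (v0 : V).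
Hypothesis adj_sym : forall u v, adj u v -> adj v u.
Hypothesis adj_irr : forall u, ~ adj u u.
Hypothesis adj_conn : forall u v, clos_refl_trans V adj u v.
Hypothesis n_gt1 : (1 < n)%N.
Notation E := (weqb adj).
Notation W := (monomial V n).
Notation EW := (weqb (@red_adj V adj n)).
Notation mon := (mon w0).
Notation lab := (lab adj w0 v0).
Notation null := (null adj).
Notation based_loop := (based_loop (@red_adj V adj n) w0).
Notation based_homotopic := (based_homotopic (@red_adj V adj n) w0).

Let n_gt0 : (0 < n)%N. Proof. exact: ltnW. Qed.
Let Erefl := weqb_refl adj.
Let Esym := weqb_sym adj_sym.
Let EWrefl := weqb_refl (@red_adj V adj n).
Let EWsym : symmetric EW := weqb_sym (@red_adj_sym V adj n).

Let is_move_lab (x y : W) : EW x y -> is_move adj w0 x y (lab x y).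
Proof. exact: labP. Qed.

(** * The homology class of a step *)

Definition step_chain (x y : W) : {ffun Qv 1 -> V} -> int := e1 (lab x y).1 (lab x y).2.

Lemma step_square (x y z t : W) : EW x y -> EW y z -> EW z t -> EW t x ->
  null (fun c => step_chain x y c + step_chain y z c + step_chain z t c + step_chain t x c).
Proof.
move=> xy yz zt tx.
exact: (null_moves4 adj_sym (is_move_lab xy) (is_move_lab yz) (is_move_lab zt) (is_move_lab tx)).
Qed.

(** Independence of the label chosen by [lab]: in the closed walk [x, y, x, y, x], only the label of
    the first step is changed. *)
Lemma step_move (x y : W) p : is_move adj w0 x y p ->
  null (fun z => step_chain x y z - e1 p.1 p.2 z).
Proof.
move=> mp; have xy : EW x y by have [pE [c [_ -> ->]]] := mp; exact: weqb_mon.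
have ml := is_move_lab xy; have mp' := is_move_sym adj_sym mp.
have n2 := null_moves4 adj_sym mp mp' mp mp'.
have n3 := null_moves4 adj_sym ml mp' mp mp'.
apply: null_ext (null_sub n3 n2) _ => z; rewrite /step_chain /=; ring.
Qed.

Lemma step_refl (x : W) : null (step_chain x x).
Proof.
have [[u v] m] := weqb_move w0 adj_sym adj_irr n_gt0 (EWrefl x).
have m' : is_move adj w0 x x (u, u).
  have [_ [c [sc xE _]]] := m; split; [exact: Erefl | by exists c].
by apply: null_ext (null_add (step_move m') (null_e1xx adj_sym u)) _ => z /=; rewrite subrK.
Qed.

Lemma step_sym (x y : W) : EW x y -> null (fun z => step_chain x y z + step_chain y x z).
Proof.
move=> xy; have yx : EW y x by rewrite EWsym.
have H := step_square xy yx (EWrefl x) (EWrefl x); have R := step_refl x.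
by apply: null_ext (null_sub H (null_add R R)) _ => z; ring.
Qed.

(** * The homology class of a based loop *)

Lemma coef_word_chain (x : W) s z :
  coef (word_chain (pairmap lab x s)) z = wsum step_chain (x :: s) z.
Proof.
elim: s x => [|y s IH] x; first by rewrite /coef big_nil.
by rewrite /= coef_cons IH.
Qed.

Definition radius (f : int -> W) : nat := xget 0%N [set r | based_at w0 f r]%classic.

Lemma radiusP f : based_loop f -> based_at w0 f (radius f).
Proof. by move=> [_ fr]; exact: xgetPex fr. Qed.

Definition Phi (f : int -> W) : chain V 1 :=
  let s := segment f (radius f) in word_chain (pairmap lab (head w0 s) (behead s)).

Notation zs := (zsum step_chain).

Lemma coef_Phi f z : coef (Phi f) z = zs f (- (radius f)%:Z) (radius f + radius f) z.
Proof.
rewrite coef_word_chain zsum_mkseq; congr (wsum _ _ z).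
transitivity (segment f (radius f)); first by [].
by apply: eq_mkseq => k; rewrite addrC.
Qed.

(** Stationary steps are null, so every window containing the moving part gives the same class; [R]
    is a common enlargement of both radii. *)
Lemma Phi_window f r a m : based_loop f -> based_at w0 f r ->
    a <= - r%:Z -> r%:Z <= a + m%:Z ->
  null (fun z => coef (Phi f) z - zs f a m z).
Proof.
move=> fb fr ar rm; have fr' := radiusP fb.
pose R := (r + radius f)%N.
have H1 : null (fun z => zs f a m z - zs f (- r%:Z) (r + r) z).
  exact: (zsum_based step_refl fr).
have H2 : null (fun z => zs f (- R%:Z) (R + R) z - zs f (- r%:Z) (r + r) z).
  by apply: (zsum_based step_refl fr); rewrite /R; lia.
have H3 : null (fun z => zs f (- R%:Z) (R + R) z - coef (Phi f) z).
  apply: (@null_ext _ _ (fun z => zs f (- R%:Z) (R + R) z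
     - zs f (- (radius f)%:Z) (radius f + radius f) z)).
    by apply: (zsum_based step_refl fr'); rewrite /R; lia.
  by move=> z; rewrite coef_Phi.
by apply: null_ext (null_sub (null_sub H2 H3) H1) _ => z; ring.
Qed.

Lemma Phi_step f g : based_loop f -> based_loop g -> (forall i, EW (f i) (g i)) ->
  null (fun z => coef (Phi f) z - coef (Phi g) z).
Proof.
move=> fb gb fg; pose R := (radius f + radius g)%N.
have fR : based_at w0 f R by apply: based_at_leq (radiusP fb); exact: leq_addr.
have gR : based_at w0 g R by apply: based_at_leq (radiusP gb); exact: leq_addl.
have Hf : null (fun z => coef (Phi f) z - zs f (- R%:Z) (R + R) z).
  by apply: Phi_window fR _ _ => //; lia.
have Hg : null (fun z => coef (Phi g) z - zs g (- R%:Z) (R + R) z).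
  by apply: Phi_window gR _ _ => //; lia.
have fE i : EW (f i) (f (i + 1)) by apply: Zmap_weqb; case: fb.
have gE i : EW (g i) (g (i + 1)) by apply: Zmap_weqb; case: gb.
(* Both end rungs join [w0] to itself and cancel. *)
have H := zsum_ladder step_sym EWsym step_square (- R%:Z) (R + R) fE gE fg.
apply: null_ext (null_add (null_sub Hf Hg) H) _ => z.
by rewrite !fR ?gR; try lia; ring.
Qed.

Lemma eq_Phi_null f g : based_loop f -> based_loop g -> f =1 g ->
  null (fun z => coef (Phi f) z - coef (Phi g) z).
Proof. by move=> fb gb fg; apply: Phi_step => // i; rewrite fg. Qed.

Lemma Phi_homotopic f g : based_loop f -> based_loop g -> based_homotopic f g ->
  null (fun z => coef (Phi f) z - coef (Phi g) z).
Proof.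
move=> fb gb [m [h [hE h0 hm hb]]].
have hbl j : (j <= m)%N -> based_loop (h^~ j).
  by move=> jm; split; [move=> i i' ii'; apply: hE => //; right | exact: hb].
have H j : (j <= m)%N -> null (fun z => coef (Phi f) z - coef (Phi (h^~ j)) z).
  elim: j => [|j IH] jm; first by apply: eq_Phi_null => //; exact: hbl.
  have Hj : null (fun z => coef (Phi (h^~ j)) z - coef (Phi (h^~ j.+1)) z).
    apply: Phi_step; [by apply: hbl; lia..|move=> i; apply/weqbP].
    by apply: hE; try lia; left; split=> //; lia.
  by apply: null_ext (null_add (IH (ltnW jm)) Hj) _ => z; ring.
have Hg : null (fun z => coef (Phi (h^~ m)) z - coef (Phi g) z).
  by apply: eq_Phi_null => //; exact: hbl.
by apply: null_ext (null_add (H m (leqnn m)) Hg) _ => z; ring.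
Qed.

Lemma Phi_product f g p : based_loop f -> based_loop g -> loop_product w0 f g p ->
  null (fun z => coef (Phi p) z - coef (Phi f ++ Phi g) z).
Proof.
move=> fb gb [rf [rg [[fr _] [[gr _] pE]]]].
(* [p] can leave [w0] only between [-2rf] and [2rg]. *)
pose R := (rf + rf + (rg + rg))%N.
have pf i : i <= 0 -> p i = f (i + rf%:Z) by case: (pE i).
have pg i : 0 <= i -> p i = g (i - rg%:Z) by case: (pE i).
have pR : based_at w0 p R.
  move=> i iR; have [i0|i0] := leP i 0.
    by rewrite pf // fr //; move: iR; rewrite /R; lia.
  by rewrite pg ?ltW // gr //; move: iR; rewrite /R; lia.
have pb : based_loop p.
  split; last by exists R.
  apply: Zmap_succ => [|i]; first exact: red_adj_sym.
  (* No step straddles 0, where both formulas for [p] hold. *)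
  have [i0|i0] := leP (i + 1) 0.
    rewrite !pf //; last by lia.
    by rewrite addrAC; apply: Zmap_weqb; case: fb.
  rewrite !pg //; try lia.
  by rewrite addrAC; apply: Zmap_weqb; case: gb.
have Hp : null (fun z => coef (Phi p) z - zs p (- R%:Z) (R + R) z).
  by apply: Phi_window pR _ _ => //; lia.
have Hf : null (fun z => coef (Phi f) z - zs f (rf%:Z - R%:Z) R z).
  by apply: Phi_window fr _ _ => //; rewrite /R; lia.
have Hg : null (fun z => coef (Phi g) z - zs g (- rg%:Z) R z).
  by apply: Phi_window gr _ _ => //; rewrite /R; lia.
apply: null_ext (null_sub Hp (null_add Hf Hg)) _ => z.
(* The window of [p] is cut at 0; the halves are translated windows of [f] and [g]. *)
rewrite zsum_add coef_cat.
have -> : zs p (- R%:Z) R z = zs f (rf%:Z - R%:Z) R z.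
  rewrite /zsum big_nat [RHS]big_nat; apply: eq_bigr => k kR.
  rewrite !pf; try lia.
  have -> : - R%:Z + k%:Z + 1 + rf%:Z = rf%:Z - R%:Z + k%:Z + 1 by ring.
  by have -> : - R%:Z + k%:Z + rf%:Z = rf%:Z - R%:Z + k%:Z by ring.
have -> : zs p (- R%:Z + R%:Z) R z = zs g (- rg%:Z) R z.
  rewrite addNr /zsum; apply: eq_bigr => k _.
  rewrite !pg; try lia.
  have -> : 0 + k%:Z + 1 - rg%:Z = - rg%:Z + k%:Z + 1 by ring.
  by have -> : 0 + k%:Z - rg%:Z = - rg%:Z + k%:Z by ring.
ring.
Qed.

(** * Injectivity on homotopy classes *)

Lemma segment_cons f r : based_loop f -> based_at w0 f r -> exists s,
  [/\ segment f r = w0 :: s, path EW w0 s & last w0 s = w0].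
Proof. by move=> fb fr; apply/walkP; exact: segment_walk. Qed.

Lemma homologous_homotopic f g : based_loop f -> based_loop g ->
  homologous1 adj (Phi f) (Phi g) -> based_homotopic f g.
Proof.
move=> fb gb; rewrite /Phi.
have [s [sE ps ls]] := segment_cons fb (radiusP fb).
have [t [tE pt lt]] := segment_cons gb (radiusP gb).
rewrite sE tE /= => H.
apply: (heq_segment_homotopic (@red_adj_sym V adj n) fb gb (radiusP fb) (radiusP gb)).
rewrite sE tE.
apply: (@homologous_loops V adj v0 n adj_sym adj_conn n_gt1 W EW mon EWrefl EWsym
  (@mon_perm V n w0) _ (fun x : W => enum_mset (val x)) lab _ _ _ _ w0 s t ps ls pt lt H).
- by move=> u v c; exact: weqb_mon.
- move=> c sc; rewrite val_mon //; exact: perm_eq_seq_mset.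
- exact: mon_enum.
- exact: size_monomial.
- exact: is_move_lab.
Qed.

(** * Loops give cycles *)

Lemma chain_eval_boundary1 (A : zmodType) (F : {ffun Qv 0 -> V} -> A) (c : chain V 1) :
  chain_eval F (boundary c) =
  \sum_(p <- c) (F (pt0 (tgt p.2)) - F (pt0 (src p.2))) *~ p.1.
Proof.
rewrite chain_eval_boundary; apply: eq_bigr => p _.
by rewrite big_ord1 !face_edge expr1 mulN1r mulrNz -mulNrz opprB.
Qed.

Lemma Phi_cycle f : based_loop f -> cycle1 adj (Phi f).
Proof.
move=> fb; rewrite /Phi; have [s [-> ps ls]] := segment_cons fb (radiusP fb).
split=> /=.
  move=> p /mapP[q qs ->] /=; apply/cube_map_edge => //; rewrite src_edge tgt_edge.
  suff H x : path EW x s -> q \in pairmap lab x s -> E q.1 q.2 by exact: H ps qs.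
  elim: s x {ps ls qs} => // y s IH x /= /andP[xy ys].
  by rewrite inE => /orP[/eqP->|]; [case: (is_move_lab xy) | exact: IH ys].
exists [::]; split=> // x; rewrite coef_chain_eval chain_eval_boundary1 /coef big_nil big_map /=.
pose w := x [ffun=> false].
have xE : x = pt0 w by apply/ffunP => t; rewrite ffunE /w (Qv0E t [ffun=> false]).
have ptE a : (pt0 a == x) = (a == w) by rewrite xE (inj_eq (@pt0_inj V)).
under eq_bigr => p _ do rewrite src_edge tgt_edge !ptE mulr1z.
(* The boundary coefficient at [w] telescopes to the change in the number of tokens at [w], which is
   zero around a loop. *)
suff H y : path EW y s -> \sum_(p <- pairmap lab y s) ((p.2 == w)%:R - (p.1 == w)%:R)
    = (val (last y s) w)%:Z - (val y w)%:Z :> int by rewrite H // ls subrr.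
elim: s y {ps ls} => [|a s IH] y /=; first by rewrite big_nil subrr.
case/andP=> ya yas; rewrite big_cons IH //.
have := is_move_count (is_move_lab ya) w; rewrite /=; lia.
Qed.

(** * Surjectivity *)

Notation tau := (tau adj v0).
Notation ell := (ell adj v0).
Notation wordwalk := (wordwalk adj v0).
Notation inc := (inc v0 n mon).
Notation incwalk := (incwalk adj v0 n mon).

(** The chain of the loop at [v0] through the edge [p], with the return counted negatively. *)
Definition tree_sum (p : V * V) (z : {ffun Qv 1 -> V}) : int :=
  wsum (@e1 V) (tau p.1) z + e1 p.1 p.2 z - wsum (@e1 V) (tau p.2) z.

Let e1_sym u v : E u v -> null (fun z => e1 u v z + e1 v u z).
Proof. exact: null_cycle2. Qed.

Lemma wsum_ell p : E p.1 p.2 ->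
  null (fun z => wsum (@e1 V) (v0 :: ell p) z - tree_sum p z).
Proof.
move=> pE; have wt := tauP v0 adj_conn; have wr := walk_rev Esym (wt p.2).
have H := wsum_rev e1_sym Esym (wt p.2).
apply: null_ext (null_add (null_e1xx adj_sym v0) H) _ => z.
rewrite /ell pE (wsum_cons _ _ _ (walk_cat (wt p.1) pE wr)).
by rewrite (wsum_cat _ _ (wt p.1) wr) /tree_sum; ring.
Qed.

Lemma wsum_wordwalk ws : all (fun p => E p.1 p.2) ws ->
  null (fun z => wsum (@e1 V) (v0 :: wordwalk ws) z - \sum_(p <- ws) tree_sum p z).
Proof.
elim: ws => [|p ws IH].
  by move=> _; apply: null_ext (null0 adj) _ => z; rewrite big_nil.
rewrite [all _ _]/=; case/andP=> pE /IH H; apply: null_ext (null_add (wsum_ell pE) H) _ => z.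
rewrite big_cons -[v0 :: wordwalk (p :: ws)]/((v0 :: ell p) ++ wordwalk ws).
rewrite (wsum_catr _ _ (ell_walk v0 adj_sym adj_conn p) (wordwalkP v0 adj_sym adj_conn ws)).
by ring.
Qed.

(** A step of the single moving token admits the traversed edge as label, and [step_move] allows
    this label in place of [lab]. *)
Lemma wsum_inc x y s : walk E x y s ->
  null (fun z => wsum step_chain (map inc s) z - wsum (@e1 V) s z).
Proof.
elim/walk_ind => [|{}x x' {}s xx' ws IH].
  by apply: null_ext (null0 adj) _ => z.
have m : is_move adj w0 (inc x) (inc x') (x, x').
  by apply: is_move_mon => //; rewrite size_nseq prednK.
apply: null_ext (null_add (step_move m) IH) _ => z.
rewrite (wsum_cons _ _ _ ws) map_cons.
case/walkP: ws => t [-> _ _] /=; ring.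
Qed.

Let enc (x : W) : seq V := enum_mset (val x).

(** The loop of the word is based where all tokens lie at [v0]; conjugating by [g] brings it to
    [w0], and the two passages along [g] cancel in homology. *)
Lemma based_loop_of_word ws : all (fun p => E p.1 p.2) ws -> exists f,
  based_loop f /\ null (fun z => coef (Phi f) z - \sum_(p <- ws) tree_sum p z).
Proof.
move=> wsE; pose g := gamma adj v0 mon enc w0.
have mon_homo u v c : E u v -> EW (mon (u :: c)) (mon (v :: c)) by exact: weqb_mon.
have wg : walk EW (inc v0) w0 g.
  apply: gamma_walk => //; [exact: mon_perm | exact: mon_enum | exact: size_monomial].
have wi : walk EW (inc v0) (inc v0) (incwalk ws) by apply: incwalkP.
have wr := walk_rev EWsym wg.
pose s := rev g ++ incwalk ws ++ g.
have wig := walk_cat wi (EWrefl _) wg.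
have wsl : walk EW w0 w0 s := walk_cat wr (EWrefl _) wig.
have fb := loop_of_based (@red_adj_sym V adj n) (walk_closed_walk wsl).
exists (loop_of w0 s); split=> //.
have [t [sE pt lt]] := walkP _ _ _ _ wsl.
have zsE z : zs (loop_of w0 s) 0 (size t) z = wsum step_chain s z.
  rewrite zsum_mkseq -[in RHS](mkseq_nth w0 s).
  by have -> : size s = (size t).+1 by rewrite sE.
have H1 : null (fun z => coef (Phi (loop_of w0 s)) z - zs (loop_of w0 s) 0 (size t) z).
  pose R := (size s).
  have fR : based_at w0 (loop_of w0 s) R.
    by case=> [k|k] //= kR; rewrite nth_default //; move: kR; rewrite /R; lia.
  have Ha : null (fun z => coef (Phi (loop_of w0 s)) z - zs (loop_of w0 s) (- R%:Z) (R + R) z).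
    by apply: Phi_window fR _ _ => //; lia.
  have Hb : null (fun z => zs (loop_of w0 s) (- R%:Z) (R + R) z - zs (loop_of w0 s) 0 (size t) z).
    apply: (zsum_window step_refl (w0 := w0)); rewrite ?/R ?sE /=; try lia.
      by case=> [[|k]|k] //=; lia.
    case=> [k|k] /= kt; last by [].
    (* At [size t] stands the last vertex of [s], which is [w0]; beyond it the default value. *)
    have [kE|kt'] := eqVneq k (size t); first by rewrite kE -[RHS]lt (last_nth w0).
    by rewrite nth_default //= ltn_neqAle eq_sym kt'; case/andP: kt; rewrite add0r lez_nat.
  by apply: null_ext (null_add Ha Hb) _ => z; ring.
have H2 := wsum_rev step_sym EWsym wg.
have H3 := wsum_inc (wordwalkP v0 adj_sym adj_conn ws).
have H4 := wsum_wordwalk wsE.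
(* Both junctions of [s] are stationary steps at [inc v0], so this is used twice. *)
have R1 := step_refl (inc v0).
apply: null_ext (null_add (null_add H1 (null_add H2 (null_add R1 R1))) (null_add H3 H4)) _ => z.
rewrite zsE /s (wsum_cat _ _ wr wig) (wsum_cat _ _ wi wg) /incwalk.
by ring.
Qed.

Lemma tree_sum_swap u v : E u v ->
  null (fun z => tree_sum (u, v) z + tree_sum (v, u) z).
Proof. by move=> uv; apply: null_ext (e1_sym uv) _ => z; rewrite /tree_sum /=; ring. Qed.

(** A multiplicity is realised by repeating a letter; a negative one, [Negz k], by [k.+1] copies of
    the reversed edge. *)
Lemma word_of_chain (c : chain V 1) : is_chain adj c -> exists ws,
  all (fun p => E p.1 p.2) ws /\
  null (fun z => \sum_(p <- ws) tree_sum p z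
               - \sum_(p <- c) tree_sum (src p.2, tgt p.2) z *~ p.1).
Proof.
elim: c => [|[m x] c IH] cc.
  by exists [::]; split=> //; apply: null_ext (null0 adj) _ => z; rewrite !big_nil.
have [ws [wsE H]] := IH (fun p pc => cc p (mem_behead (s := _ :: _) pc)).
have xE : E (src x) (tgt x).
  by apply/cube_map_edge => //; exact: (cc (m, x) (mem_head _ _)).
case: m cc => k cc.
  exists (nseq k (src x, tgt x) ++ ws); split.
    by rewrite all_cat wsE andbT; apply/allP => p /nseqP[-> _].
  apply: null_ext H _ => z; rewrite big_cat big_cons /= big_nseq iter_addr addr0.
  by rewrite pmulrn; ring.
exists (nseq k.+1 (tgt x, src x) ++ ws); split.
  by rewrite all_cat wsE andbT; apply/allP => p /nseqP[-> _]; rewrite /= Esym.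
have Hk := null_mulz k.+1%:Z (tree_sum_swap xE).
apply: null_ext (null_add H Hk) _ => z.
rewrite big_cat big_nseq iter_addr addr0 [X in _ = _ - X]big_cons.
by rewrite /= NegzE mulrzz -mulr_natr natz; ring.
Qed.

Lemma Phi_surjective c : cycle1 adj c -> exists f,
  based_loop f /\ homologous1 adj (Phi f) c.
Proof.
move=> [cc [d [dd cd]]]; have [ws [wsE H]] := word_of_chain cc.
have [f [fb Hf]] := based_loop_of_word wsE.
exists f; split=> //; apply/homologous1P.
apply: null_ext (null_add Hf H) _ => z.
(* No 0-cube is degenerate, so the boundary of [c] has all coefficients zero. *)
have d0 : d = [::] by case: d dd {cd} => // p d /(_ p (mem_head _ _)) [].
(* Sending a vertex to the chain of its [tau] is linear on 0-chains, hence vanishes on the boundary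
   of [c]: the tree walks cancel. *)
have := eq_chain_eval (fun y => wsum (@e1 V) (tau (y [ffun=> false])) z) cd.
rewrite chain_eval_boundary1 d0 /chain_eval big_nil => bd.
have -> : \sum_(p <- c) tree_sum (src p.2, tgt p.2) z *~ p.1 =
  coef c z - \sum_(p <- c) (wsum (@e1 V) (tau (pt0 (tgt p.2) [ffun=> false])) z
    - wsum (@e1 V) (tau (pt0 (src p.2) [ffun=> false])) z) *~ p.1.
  rewrite coef_chain_eval /chain_eval -sumrB; apply: eq_bigr => p _.
  have e1E : e1 (src p.2) (tgt p.2) z = (p.2 == z)%:R by rewrite /e1 -edgeE.
  by rewrite /tree_sum e1E !ffunE -mulrzBl; congr (_ *~ _); ring.
rewrite bd; ring.
Qed.
End ReducedPower.


(* A group isomorphism A_1(G^(n), w0) ≅ H_1(G), given at the level of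
   representatives: Phi sends based loops to 1-cycles, is compatible with
   and reflects the two equivalence relations, is onto classes, and sends
   products to sums. *)
Theorem theorem1p1 (V : choiceType) (adj : V -> V -> Prop) (n : nat)
    (w0 : monomial V n) :
  is_graph adj -> (2 <= n)%N ->
  exists Phi : (int -> monomial V n) -> chain V 1,
    [/\ (forall f, based_loop (@red_adj V adj n) w0 f -> cycle1 adj (Phi f)),
        (forall f g, based_loop (@red_adj V adj n) w0 f ->
                     based_loop (@red_adj V adj n) w0 g ->
           (based_homotopic (@red_adj V adj n) w0 f g <->
            homologous1 adj (Phi f) (Phi g))),
        (forall z, cycle1 adj z ->
           exists f, based_loop (@red_adj V adj n) w0 f /\
                     homologous1 adj (Phi f) z) &
        (forall f g p, based_loop (@red_adj V adj n) w0 f ->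
                       based_loop (@red_adj V adj n) w0 g ->
                       loop_product w0 f g p ->
           homologous1 adj (Phi p) (Phi f ++ Phi g))].
Proof.
move=> [adj_sym adj_irr adj_conn _] n_gt1.
(* The auxiliary vertex [v0] may be any vertex; a token of [w0] supplies one. *)
case w0E : (enum_mset (val w0)) (size_monomial w0) => [|v0 c] w0n.
  by exfalso; move: n_gt1; rewrite -w0n.
exists (Phi adj w0 v0); split.
- by move=> f; exact: Phi_cycle.
- move=> f g fb gb; split; last exact: homologous_homotopic.
  by move=> fg; apply/homologous1P; exact: Phi_homotopic.
- by move=> z; exact: Phi_surjective.
- by move=> f g p fb gb fgp; apply/homologous1P; exact: Phi_product.
Qed.
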